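(* Let $s>0$ and $d\in\mathbb{N}$, and let $n\in\mathbb{N}$. Then $$a_n(I_d:H^{s,+}_{\rm mix}(\mathbb{T}^d)\to L_2(\mathbb{T}^d))\le\Big[\frac{(3\cdot\sqrt2)^d}{(d-1)!}\Big]^s\frac{(\ln n)^{(d-1)s}}{n^s}\qquad\text{if } n\ge27^d,$$ and $$a_n(I_d:H^{s,+}_{\rm mix}(\mathbb{T}^d)\to L_2(\mathbb{T}^d))\ge\Big[\frac{3}{d!}\Big(\frac{2}{2+\ln12}\Big)^d\Big]^s\frac{(\ln n)^{(d-1)s}}{n^s}\qquad\text{if } n>(12\,e^2)^d .$$
   Context: $\mathbb{N}=\{1,2,3,\dots\}$. $\mathbb{T}^d$ is the $d$-torus, represented by $[0,2\pi]^d$ with opposite sides identified. $L_2(\mathbb{T}^d)$ carries the norm $\|f|L_2(\mathbb{T}^d)\|=(\int_{\mathbb{T}^d}|f(x)|^2dx)^{1/2}$, and for $f\in L_2(\mathbb{T}^d)$ the Fourier coefficients are $c_k(f)=(2\pi)^{-d/2}\int_{\mathbb{T}^d}f(x)e^{-ikx}dx$, $k\in\mathbb{Z}^d$ (so $\|f|L_2(\mathbb{T}^d)\|^2=\sum_k|c_k(f)|^2$). For $s>0$, $H^{s,+}_{\rm mix}(\mathbb{T}^d)$ is the space of all $f\in L_2(\mathbb{T}^d)$ for which the norm $$\|f|H^s_{\rm mix}(\mathbb{T}^d)\|^{+}=\Big[\sum_{k\in\mathbb{Z}^d}|c_k(f)|^2\prod_{j=1}^d(1+|k_j|^2)^{s}\Big]^{1/2}$$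 is finite, equipped with this norm. $I_d$ denotes the identical embedding $f\mapsto f$. The approximation numbers of a bounded linear operator $T:X\to Y$ between Banach spaces are $a_n(T:X\to Y)=\inf\{\|T-A:X\to Y\| : A:X\to Y \text{ bounded linear},\ {\rm rank}\,A<n\}$, $n\in\mathbb{N}$. *)

(* Defs.v *)
From HB Require Import structures.
From mathcomp Require Import all_boot all_order all_algebra.
From mathcomp Require Import generic_quotient ring_quotient.
From mathcomp Require Import all_classical all_reals all_analysis.
From mathcomp Require Import measurable_realfun.
From mathcomp Require Import ring lra.
From mathcomp Require Import complex.

Set Implicit Arguments.
Unset Strict Implicit.
Unset Printing Implicit Defensive.

Import Order.TTheory GRing.Theory Num.Theory.
Import numFieldNormedType.Exports.

Local Open Scope classical_set_scope.
Local Open Scope ring_scope.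
Local Open Scope quotient_scope.
Local Open Scope complex_scope.

Local Notation Re := (@complex.Re _).
Local Notation Im := (@complex.Im _).

(* [NX] and [NY] are the norms of the Banach spaces [X] and [Y]. They are plain
   functions because definiteness of the mixed Sobolev norm below amounts to
   completeness of the trigonometric system. *)
Section ApproximationNumbers.
Context {R : realType} {X Y : lmodType R[i]}.
Variables (NX : X -> R) (NY : Y -> R).

Definition bounded_operator (A : X -> Y) : Prop :=
  exists M : R, forall x, NY (A x) <= M * NX x.

Definition operator_norm (A : X -> Y) : \bar R :=
  ereal_sup [set (NY (A x))%:E | x in [set x | NX x <= 1]].

(* The range of [A] has a basis with [r] elements. *)
Definition has_rank (A : X -> Y) (r : nat) : Prop :=
  exists e : 'I_r -> X,
    (forall c : 'I_r -> R[i],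
       \sum_(i < r) c i *: A (e i) = 0 -> forall i, c i = 0) /\
    (forall x, exists c : 'I_r -> R[i],
       A x = \sum_(i < r) c i *: A (e i)).

Definition approximation_number (n : nat) (T : {linear X -> Y}) : \bar R :=
  ereal_inf [set operator_norm (fun x => T x - A x) | A in
    [set A : {linear X -> Y} |
      bounded_operator A /\ exists2 r, (r < n)%N & has_rank A r]].

End ApproximationNumbers.

Section TorusMeasure.
Context {R : realType}.

(* A point of the d-torus is a tuple of [d] reals, and the measure is the d-fold
   product of the Lebesgue measure restricted to [0, 2 pi]: everything outside
   the cube, and the identification of its opposite faces, is negligible. *)
Definition circle_dom : set (measurableTypeR R) := `[0, 2 * pi]%classic.

Lemma measurable_circle_dom : measurable circle_dom.
Proof. exact: measurable_itv. Qed.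

Lemma circle_dom_lty : (lebesgue_measure circle_dom < +oo)%E.
Proof.
by rewrite /circle_dom lebesgue_measure_itv/=; case: ifP => _; rewrite ltry.
Qed.

Definition circle_measure :
    {finite_measure set (measurableTypeR R) -> \bar R} :=
  mfrestr measurable_circle_dom circle_dom_lty.

Definition tuple_cons n
    (p : measurableTypeR R * n.-tuple (measurableTypeR R)) :
  n.+1.-tuple (measurableTypeR R) := [tuple of p.1 :: p.2].

Lemma measurable_tuple_cons n : measurable_fun [set: _] (@tuple_cons n).
Proof. exact: (@measurable_cons _ _ _ _ fst _ snd). Qed.

HB.instance Definition _ n :=
  isMeasurableFun.Build _ _ _ _ (@tuple_cons n) (@measurable_tuple_cons n).

Section Dim0.

Definition torus_measure0 : set (0.-tuple (measurableTypeR R)) -> \bar R :=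
  dirac [tuple].

HB.instance Definition _ := Measure.on torus_measure0.

Let torus_measure0_fin : fin_num_fun torus_measure0.
Proof. by move=> A _; rewrite /torus_measure0 diracE. Qed.

HB.instance Definition _ :=
  Measure_isFinite.Build _ _ _ torus_measure0 torus_measure0_fin.

End Dim0.

Section DimS.
Variables (n : nat)
  (m : {finite_measure set (n.-tuple (measurableTypeR R)) -> \bar R}).

Definition torus_measureS : set (n.+1.-tuple (measurableTypeR R)) -> \bar R :=
  pushforward (circle_measure \x m)%E (@tuple_cons n).

Let torus_measureS0 : torus_measureS set0 = 0%E.
Proof. exact: measure0. Qed.

Let torus_measureS_ge0 A : (0 <= torus_measureS A)%E.
Proof. exact: measure_ge0. Qed.

Let torus_measureS_sigma_additive : semi_sigma_additive torus_measureS.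
Proof. exact: measure_semi_sigma_additive. Qed.

HB.instance Definition _ := isMeasure.Build _ _ _ torus_measureS
  torus_measureS0 torus_measureS_ge0 torus_measureS_sigma_additive.

Let torus_measureS_fin : fin_num_fun torus_measureS.
Proof.
move=> A mA; rewrite ge0_fin_numE//.
apply: (@le_lt_trans _ _ (torus_measureS setT)); first by rewrite le_measure ?inE.
rewrite /torus_measureS /pushforward preimage_setT -setXTT product_measure1E//.
by apply: lte_mul_pinfty => //; rewrite ?ltey_eq ?fin_num_measure.
Qed.

HB.instance Definition _ :=
  Measure_isFinite.Build _ _ _ torus_measureS torus_measureS_fin.

End DimS.

Fixpoint torus_measure (d : nat) :
    {finite_measure set (d.-tuple (measurableTypeR R)) -> \bar R} :=
  if d is d'.+1 then torus_measureS (torus_measure d') else torus_measure0.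

End TorusMeasure.

Section L2.
Context {R : realType} (d : nat).

Local Notation point := (d.-tuple (measurableTypeR R)).
Local Notation mu := (@torus_measure R d).

(* [R[i]^o] is [R[i]] seen as a module over itself. *)
Definition square_integrable : {pred (point -> R[i]^o)} :=
  [pred f : point -> R[i]^o |
    `[< [/\ measurable_fun [set: point] (fun x => Re (f x) : R),
            measurable_fun [set: point] (fun x => Im (f x) : R) &
            (\int[mu]_x (Normc.normc (f x) ^+ 2)%:E < +oo)%E] >]].

Lemma normc2E (z : R[i]) : Normc.normc z ^+ 2 = Re z ^+ 2 + Im z ^+ 2.
Proof. by case: z => a b; rewrite sqr_sqrtr// addr_ge0// sqr_ge0. Qed.

Lemma Re_scale (a z w : R[i]) :
  Re (a * z + w) = Re a * Re z - Im a * Im z + Re w.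
Proof. by case: a z w => ? ? [? ?] [? ?]. Qed.

Lemma Im_scale (a z w : R[i]) :
  Im (a * z + w) = Re a * Im z + Im a * Re z + Im w.
Proof. by case: a z w => ? ? [? ?] [? ?]. Qed.

Lemma normc2_scale (a z w : R[i]) : Normc.normc (a * z + w) ^+ 2 <=
  2 * Normc.normc a ^+ 2 * Normc.normc z ^+ 2 + 2 * Normc.normc w ^+ 2.
Proof.
rewrite !normc2E Re_scale Im_scale.
move: (Re a) (Im a) (Re z) (Im z) (Re w) (Im w) => p q r s t u.
rewrite -subr_ge0.
rewrite (_ : _ - _ =
  (p * r - q * s - t) ^+ 2 + (p * s + q * r - u) ^+ 2); last by ring.
by rewrite addr_ge0// sqr_ge0.
Qed.

Lemma measurable_normc2 (f : point -> R[i]) :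
  measurable_fun [set: point] (fun x => Re (f x) : R) ->
  measurable_fun [set: point] (fun x => Im (f x) : R) ->
  measurable_fun [set: point] (fun x => Normc.normc (f x) ^+ 2).
Proof.
move=> mr mi; under eq_fun do rewrite normc2E.
by apply: measurable_funD; exact: measurable_funX.
Qed.

Lemma square_integrable_submod : submod_closed square_integrable.
Proof.
split.
  apply/asboolP; split; [exact: measurable_cst|exact: measurable_cst|].
  rewrite (eq_integral (cst 0%E)) ?integral0 ?ltry// => x _.
  by rewrite normc2E/= !expr0n/= addr0.
move=> a f g /asboolP[mfr mfi fi] /asboolP[mgr mgi gi]; apply/asboolP.
have mr : measurable_fun [set: point] (fun x => Re ((a *: f + g) x) : R).
  rewrite (_ : (fun x => _) = (fun x =>
    Re a * Re (f x) - Im a * Im (f x) + Re (g x))); last first.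
    by apply/funext => x; rewrite -Re_scale.
  apply: measurable_funD => //; apply: measurable_funB;
    exact: measurable_funM.
have mi : measurable_fun [set: point] (fun x => Im ((a *: f + g) x) : R).
  rewrite (_ : (fun x => _) = (fun x =>
    Re a * Im (f x) + Im a * Re (f x) + Im (g x))); last first.
    by apply/funext => x; rewrite -Im_scale.
  apply: measurable_funD => //; apply: measurable_funD;
    exact: measurable_funM.
split=> //.
have mf2 := measurable_normc2 mfr mfi; have mg2 := measurable_normc2 mgr mgi.
apply: (@le_lt_trans _ _ (\int[mu]_x
  ((2 * Normc.normc a ^+ 2)%:E * (Normc.normc (f x) ^+ 2)%:E
   + 2%:E * (Normc.normc (g x) ^+ 2)%:E))%E).
  apply: ge0_le_integral => //.
  - by move=> x _; rewrite lee_fin sqr_ge0.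
  - by apply/measurable_EFinP; exact: measurable_normc2.
  - apply: emeasurable_funD; apply: emeasurable_funM => //;
      exact/measurable_EFinP.
  - move=> x _; rewrite -!EFinM -EFinD lee_fin; exact: normc2_scale.
have a0 : 0 <= 2 * Normc.normc a ^+ 2 by rewrite mulr_ge0// sqr_ge0.
rewrite ge0_integralD//; last 4 first.
- by move=> x _; rewrite -EFinM lee_fin mulr_ge0// sqr_ge0.
- by apply: emeasurable_funM => //; exact/measurable_EFinP.
- by move=> x _; rewrite -EFinM lee_fin mulr_ge0// sqr_ge0.
- by apply: emeasurable_funM => //; exact/measurable_EFinP.
rewrite !ge0_integralZl_EFin//; try exact/measurable_EFinP;
  try by move=> x _; rewrite lee_fin sqr_ge0.
by rewrite lte_add_pinfty// lte_mul_pinfty// lee_fin.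
Qed.

HB.instance Definition _ := GRing.isSubmodClosed.Build _ _
  square_integrable square_integrable_submod.

Record sqfun := SqFun {
  sqfun_val :> point -> R[i]^o;
  _ : sqfun_val \in square_integrable }.

HB.instance Definition _ := [isSub for sqfun_val].
HB.instance Definition _ := [Choice of sqfun by <:].
HB.instance Definition _ := [SubChoice_isSubLmodule of sqfun by <:].

Definition ae_zero : {pred sqfun} :=
  [pred f : sqfun | `[< {ae mu, forall x, f x = 0} >]].

Lemma ae_zero_zmod : zmod_closed ae_zero.
Proof.
split=> [|f g /asboolP f0 /asboolP g0]; apply/asboolP.
  by apply: filterE => x.
by apply: filterS2 f0 g0 => x fx gx; rewrite -[LHS]/(f x - g x) fx gx subrr.
Qed.

HB.instance Definition _ := GRing.isZmodClosed.Build _ ae_zero ae_zero_zmod.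

Lemma ae_zeroZ (a : R[i]) f : f \in ae_zero -> a *: f \in ae_zero.
Proof.
by move=> /asboolP f0; apply/asboolP; apply: filterS f0 => x fx;
  rewrite -[LHS]/(a *: f x) fx scaler0.
Qed.

(* Classes of square-integrable functions modulo equality almost everywhere.
   The norm and the Fourier coefficients are computed on the representative
   [repr u]; [L2norm_pi] and [fourier_coef_pi] show independence of it. *)
Definition L2 : Type := Quotient.quot ae_zero.

HB.instance Definition _ := Choice.on L2.
HB.instance Definition _ := EqQuotient.on L2.
HB.instance Definition _ := GRing.Zmodule.on L2.

Lemma L2_eqP (f g : sqfun) :
  reflect (\pi_L2 f = \pi_L2 g) (f - g \in ae_zero).
Proof.
by apply: (iffP idP) => [|/eqP]; [rewrite (Quotient.idealrBE ae_zero) => /eqP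
  |rewrite (Quotient.idealrBE ae_zero)].
Qed.

Lemma L2_piD (f g : sqfun) : \pi_L2 (f + g) = \pi_L2 f + \pi_L2 g.
Proof. exact: Quotient.pi_add. Qed.

Definition L2_scale (a : R[i]) (u : L2) : L2 := \pi_L2 (a *: repr u).

Lemma L2_scale_pi (a : R[i]) (f : sqfun) :
  L2_scale a (\pi_L2 f) = \pi_L2 (a *: f).
Proof.
apply/L2_eqP; rewrite -scalerBr; apply: ae_zeroZ; apply/L2_eqP.
by rewrite reprK.
Qed.

Lemma L2_scaleA a b u : L2_scale a (L2_scale b u) = L2_scale (a * b) u.
Proof. by rewrite -[u]reprK (L2_scale_pi b) !L2_scale_pi scalerA. Qed.

Lemma L2_scale1 : left_id 1 L2_scale.
Proof. by move=> u; rewrite -[u]reprK L2_scale_pi scale1r. Qed.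

Lemma L2_scaleDr : right_distributive L2_scale +%R.
Proof.
move=> a u v; rewrite -[u]reprK -[v]reprK.
by rewrite -L2_piD !L2_scale_pi scalerDr L2_piD.
Qed.

Lemma L2_scaleDl u : {morph L2_scale^~ u : a b / a + b}.
Proof. by move=> a b; rewrite -[u]reprK /= !L2_scale_pi scalerDl L2_piD. Qed.

HB.instance Definition _ := GRing.Zmodule_isLmodule.Build R[i] L2
  L2_scaleA L2_scale1 L2_scaleDr L2_scaleDl.

Lemma repr_L2_linear (a : R[i]) (u v : L2) :
  {ae mu, forall x, repr (a *: u + v) x = a * repr u x + repr v x}.
Proof.
have : \pi_L2 (repr (a *: u + v)) = \pi_L2 (a *: repr u + repr v).
  by rewrite reprK L2_piD -L2_scale_pi !reprK.
move=> /L2_eqP /asboolP; apply: filterS => x.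
rewrite -[X in X = _ -> _]/(repr (a *: u + v) x - (a * repr u x + repr v x)).
by move=> /eqP; rewrite subr_eq0 => /eqP.
Qed.

Definition L2norm (u : L2) : R :=
  Num.sqrt (\int[mu]_x (Normc.normc (repr u x) ^+ 2)).

(* [expi t] is e^(i t). *)
Definition expi (t : R) : R[i] := cos t +i* sin t.

Definition dotp (k : d.-tuple int) (x : point) : R :=
  \sum_(j < d) (tnth k j)%:~R * (tnth x j : R).

Definition complex_integral (f : point -> R[i]) : R[i] :=
  (\int[mu]_x (Re (f x) : R)) +i* (\int[mu]_x (Im (f x) : R)).

Definition fourier_coef (k : d.-tuple int) (u : L2) : R[i] :=
  ((2 * pi) `^ (- (d%:R / 2)))%:C *
  complex_integral (fun x => repr u x * expi (- dotp k x)).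

Lemma measurable_dotp k : measurable_fun [set: point] (fun x => - dotp k x).
Proof.
apply: measurableT_comp => //.
apply: (@measurable_sum _ _ _ _ _ _
  (fun (j : 'I_d) (x : point) => (tnth k j)%:~R * (tnth x j : R))) => j.
apply: measurable_funM => //; exact: measurable_tnth.
Qed.

Lemma sqfun_integrable (f : sqfun) (y : point -> R) :
  measurable_fun [set: point] y ->
  (forall x, y x ^+ 2 <= Normc.normc (f x) ^+ 2) ->
  mu.-integrable [set: point] (EFin \o y).
Proof.
case: f => f /= /asboolP[mr mi fi] my yf.
have m2 : measurable_fun [set: point] (fun x => (Normc.normc (f x) ^+ 2)%:E).
  by apply/measurable_EFinP; exact: measurable_normc2.
apply: (@le_integrable _ _ _ mu _ _ _
  (fun x => (1 + Normc.normc (f x) ^+ 2)%:E)) => //.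
- exact/measurable_EFinP.
- move=> x _; rewrite /= lee_fin [leRHS]ger0_norm ?addr_ge0 ?sqr_ge0//.
  apply: (@le_trans _ _ (1 + y x ^+ 2)); last by rewrite lerD2l.
  rewrite -[y x ^+ 2]real_normK ?num_real//.
  have := normr_ge0 (y x); move: `|y x| => t t0; nra.
- apply: (@eq_integrable _ _ _ mu _ _
    (cst 1%:E \+ (fun x => (Normc.normc (f x) ^+ 2)%:E))%E) => //.
  apply: integrableD => //; first exact: finite_measure_integrable_cst.
  apply/integrableP; split=> //.
  by under eq_integral do rewrite gee0_abs ?lee_fin ?sqr_ge0//.
Qed.

Lemma measurable_sqfun (f : sqfun) :
  measurable_fun [set: point] (fun x => Re (f x) : R) /\
  measurable_fun [set: point] (fun x => Im (f x) : R).
Proof. by case: f => f /= /asboolP[]. Qed.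

Lemma Re_expiE (z : R[i]) (t : R) :
  Re (z * expi t) = Re z * cos t - Im z * sin t.
Proof. by case: z. Qed.

Lemma Im_expiE (z : R[i]) (t : R) :
  Im (z * expi t) = Re z * sin t + Im z * cos t.
Proof. by case: z. Qed.

Lemma measurable_cos_dotp k :
  measurable_fun [set: point] (fun x => cos (- dotp k x)).
Proof.
apply: (@measurableT_comp _ _ _ _ _ _ (@cos R)); last exact: measurable_dotp.
by apply: continuous_measurable_fun; exact: continuous_cos.
Qed.

Lemma measurable_sin_dotp k :
  measurable_fun [set: point] (fun x => sin (- dotp k x)).
Proof.
apply: (@measurableT_comp _ _ _ _ _ _ (@sin R)); last exact: measurable_dotp.
by apply: continuous_measurable_fun; exact: continuous_sin.
Qed.

Lemma Re_integrable k (f : sqfun) :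
  mu.-integrable [set: point]
    (EFin \o (fun x => Re (f x * expi (- dotp k x)) : R)).
Proof.
have [mr mi] := measurable_sqfun f.
apply: (@sqfun_integrable f) => [|x].
  under eq_fun do rewrite Re_expiE.
  by apply: measurable_funB; apply: measurable_funM => //;
    [exact: measurable_cos_dotp|exact: measurable_sin_dotp].
rewrite Re_expiE normc2E; have := cos2Dsin2 (- dotp k x).
move: (cos _) (sin _) (Re _) (Im _) => c t p q ct.
rewrite -subr_ge0 -[X in 0 <= X - _]mulr1 -ct.
rewrite (_ : _ - _ = (p * t + q * c) ^+ 2) ?sqr_ge0//; by ring.
Qed.

Lemma Im_integrable k (f : sqfun) :
  mu.-integrable [set: point]
    (EFin \o (fun x => Im (f x * expi (- dotp k x)) : R)).
Proof.
have [mr mi] := measurable_sqfun f.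
apply: (@sqfun_integrable f) => [|x].
  under eq_fun do rewrite Im_expiE.
  by apply: measurable_funD; apply: measurable_funM => //;
    [exact: measurable_sin_dotp|exact: measurable_cos_dotp].
rewrite Im_expiE normc2E; have := cos2Dsin2 (- dotp k x).
move: (cos _) (sin _) (Re _) (Im _) => c t p q ct.
rewrite -subr_ge0 -[X in 0 <= X - _]mulr1 -ct.
rewrite (_ : _ - _ = (p * c - q * t) ^+ 2) ?sqr_ge0//; by ring.
Qed.

Lemma ae_eq_Rintegral_torus (f g : point -> R) :
  mu.-integrable [set: point] (EFin \o f) ->
  mu.-integrable [set: point] (EFin \o g) ->
  {ae mu, forall x, f x = g x} -> \int[mu]_x f x = \int[mu]_x g x.
Proof.
move=> /measurable_int mf /measurable_int mg fg.
rewrite /Rintegral; congr fine; apply: ae_eq_integral => //.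
by apply: filterS fg => x /= ->.
Qed.

Lemma fourier_coef_linear k (a : R[i]) u v :
  fourier_coef k (a *: u + v) = a * fourier_coef k u + fourier_coef k v.
Proof.
rewrite /fourier_coef mulrCA -mulrDr; congr (_ * _).
pose e x := expi (- dotp k x).
have Ru := Re_integrable k (repr u); have Iu := Im_integrable k (repr u).
have Rv := Re_integrable k (repr v); have Iv := Im_integrable k (repr v).
have Zi (b : R) (h : point -> R) : mu.-integrable [set: point] (EFin \o h) ->
    mu.-integrable [set: point] (EFin \o (fun x => b * h x)).
  by move=> ih; rewrite (_ : _ \o _ = (fun x => b%:E * (h x)%:E)%E)//;
    exact: integrableZl.
have Di (h h' : point -> R) : mu.-integrable [set: point] (EFin \o h) ->
    mu.-integrable [set: point] (EFin \o h') ->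
    mu.-integrable [set: point] (EFin \o (fun x => h x + h' x)).
  by move=> ih ih'; apply: (@eq_integrable _ _ _ mu _ _
    ((EFin \o h) \+ (EFin \o h'))%E) => //; exact: integrableD.
have Bi (h h' : point -> R) : mu.-integrable [set: point] (EFin \o h) ->
    mu.-integrable [set: point] (EFin \o h') ->
    mu.-integrable [set: point] (EFin \o (fun x => h x - h' x)).
  by move=> ih ih'; apply: (@eq_integrable _ _ _ mu _ _
    ((EFin \o h) \- (EFin \o h'))%E) => //; exact: integrableB.
have lin := repr_L2_linear a u v.
apply/eqP; rewrite eq_complex; apply/andP; split; apply/eqP.
- rewrite Re_scale /complex_integral/=.
  rewrite -!RintegralZl// -RintegralB//; [|exact: Zi..].
  rewrite -RintegralD//; last by apply: Bi; exact: Zi.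
  apply: ae_eq_Rintegral_torus; first exact: Re_integrable.
    by apply: Di => //; apply: Bi; exact: Zi.
  by apply: filterS lin => x ->; rewrite mulrDl -mulrA Re_scale.
- rewrite Im_scale /complex_integral/=.
  rewrite -!RintegralZl// -RintegralD//; [|exact: Zi..].
  rewrite -RintegralD//; last by apply: Di; exact: Zi.
  apply: ae_eq_Rintegral_torus; first exact: Im_integrable.
    by apply: (Di) => //; apply: (Di); exact: Zi.
  by apply: filterS lin => x ->; rewrite mulrDl -mulrA Im_scale.
Qed.

Lemma repr_L2_pi (f : sqfun) : {ae mu, forall x, repr (\pi_L2 f) x = f x}.
Proof.
have /L2_eqP/asboolP : \pi_L2 (repr (\pi_L2 f)) = \pi_L2 f by rewrite reprK.
apply: filterS => x.
rewrite -[X in X = _ -> _]/(repr (\pi_L2 f) x - f x).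
by move=> /eqP; rewrite subr_eq0 => /eqP.
Qed.

Lemma sqfun_normc2_integrable (f : sqfun) :
  mu.-integrable [set: point] (EFin \o (fun x => Normc.normc (f x) ^+ 2)).
Proof.
case: f => f /= /asboolP[mr mi fi]; apply/integrableP; split.
  by apply/measurable_EFinP; exact: measurable_normc2.
by under eq_integral do rewrite gee0_abs ?lee_fin ?sqr_ge0//.
Qed.

Lemma L2norm_pi (f : sqfun) :
  L2norm (\pi_L2 f) = Num.sqrt (\int[mu]_x (Normc.normc (f x) ^+ 2)).
Proof.
congr Num.sqrt; apply: ae_eq_Rintegral_torus;
  [exact: sqfun_normc2_integrable|exact: sqfun_normc2_integrable|].
by apply: filterS (repr_L2_pi f) => x ->.
Qed.

Lemma fourier_coef_pi k (f : sqfun) : fourier_coef k (\pi_L2 f) =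
  ((2 * pi) `^ (- (d%:R / 2)))%:C *
  complex_integral (fun x => f x * expi (- dotp k x)).
Proof.
congr (_ * (_ +i* _)); apply: ae_eq_Rintegral_torus;
  try exact: Re_integrable; try exact: Im_integrable;
  by apply: filterS (repr_L2_pi f) => x ->.
Qed.

Definition mix_weight (s : R) (k : d.-tuple int) : R :=
  \prod_(j < d) (1 + `|(tnth k j)%:~R| ^+ 2) `^ s.

Definition Hmix_norm2 (s : R) (u : L2) : \bar R :=
  \esum_(k in [set: d.-tuple int])
    (Normc.normc (fourier_coef k u) ^+ 2 * mix_weight s k)%:E.

Definition in_Hmix (s : R) : {pred L2} :=
  [pred u | `[< (Hmix_norm2 s u < +oo)%E >]].

Lemma mix_weight_ge0 s k : 0 <= mix_weight s k.
Proof. by apply: prodr_ge0 => j _; exact: powR_ge0. Qed.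

Lemma in_Hmix_submod s : submod_closed (in_Hmix s).
Proof.
pose t (u : L2) k :=
  (Normc.normc (fourier_coef k u) ^+ 2 * mix_weight s k)%:E.
have t0 u k : (0 <= t u k)%E.
  by rewrite lee_fin mulr_ge0 ?sqr_ge0// mix_weight_ge0.
split.
  apply/asboolP; rewrite /Hmix_norm2 esum1 ?ltry// => k _.
  have /eqP := fourier_coef_linear k 1 0 0.
  rewrite scale1r addr0 mul1r -subr_eq subrr eq_sym => /eqP ->.
  by rewrite normc2E/= !expr0n/= addr0 mul0r.
move=> a u v /asboolP uH /asboolP vH; apply/asboolP.
have a0 : 0 <= 2 * Normc.normc a ^+ 2 by rewrite mulr_ge0// sqr_ge0.
apply: (@le_lt_trans _ _ ((2 * Normc.normc a ^+ 2)%:E * Hmix_norm2 s u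
  + 2%:E * Hmix_norm2 s v)%E); last first.
  by rewrite lte_add_pinfty// lte_mul_pinfty// lee_fin.
apply: ge_ereal_sup => _ [A [finA _] <-].
apply: (@le_trans _ _ (\sum_(k \in A)
  ((2 * Normc.normc a ^+ 2)%:E * t u k + 2%:E * t v k))%E).
  apply: lee_fsum => // k _; rewrite -!EFinM -EFinD lee_fin.
  rewrite fourier_coef_linear; move: (fourier_coef k u) (fourier_coef k v) => z w.
  rewrite (mulrA (2 * _)) (mulrA 2 _ (mix_weight s k)) -mulrDl.
  by rewrite ler_wpM2r ?mix_weight_ge0//; exact: normc2_scale.
rewrite fsbig_split//= -!ge0_mule_fsumr//; apply: leeD.
- rewrite lee_wpmul2l ?lee_fin//; apply: ereal_sup_ubound; exists A => //.
- rewrite lee_wpmul2l ?lee_fin//; apply: ereal_sup_ubound; exists A => //.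
Qed.

HB.instance Definition _ s := GRing.isSubmodClosed.Build _ _
  (in_Hmix s) (in_Hmix_submod s).

Record Hmix (s : R) := MkHmix {
  Hmix_val : L2;
  _ : Hmix_val \in in_Hmix s }.

HB.instance Definition _ s := [isSub for @Hmix_val s].
HB.instance Definition _ s := [Choice of Hmix s by <:].
HB.instance Definition _ s := [SubChoice_isSubLmodule of Hmix s by <:].

Definition Hmix_norm (s : R) (f : Hmix s) : R :=
  Num.sqrt (fine (Hmix_norm2 s (val f))).

Definition Hmix_embedding (s : R) : {linear Hmix s -> L2} := val.

End L2.

(* Main.v *)
(** The embedding is diagonal in the Fourier basis: truncating to the
    frequencies of small weight bounds [a_n] from above (by Parseval's identity),
    and a kernel vector of an operator of rank less than [n], taken among the
    combinations of [n] frequencies of small weight, bounds it from below.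
    The theorem thus amounts to counting hyperbolic crosses.

    Completeness: with [y = 1/2 - (cos (x_j - b/2) - cos (b/2)) / 4], the
    trigonometric polynomials [(1 - y^m)^(2^m)] stay in [[0, 1]] and converge
    almost everywhere to the indicator of [x_j < b]. Products give boxes,
    Dynkin's theorem gives all measurable sets, and simple functions give [L2].

    Counting, by induction on [d], slicing along one coordinate and comparing
    [sum_j ln(r/j)^m / j] with [ln(r)^(m+1) / (m+1)]. From above,
    [sqrt (1 + k^2) >= (1 + |k|) / sqrt 2] and
    [#{prod (1 + |k_j|) <= r} <= 2^d r (ln r + d - 1)^(d-1) / (d-1)!]; from
    below, [sqrt (1 + k^2) <= 1 + |k|] and
    [#{prod (1 + k_j^2) <= r^2} >= r ln(r)^(d-1) / ((d-1)! sqrt 2)]. *)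

Require Import Defs.
From HB Require Import structures.
From mathcomp Require Import all_boot all_order all_algebra.
From mathcomp Require Import generic_quotient.
From mathcomp Require Import all_classical all_reals all_analysis.
From mathcomp Require Import measurable_realfun.
From mathcomp Require Import ring lra complex.

Set Implicit Arguments.
Unset Strict Implicit.
Unset Printing Implicit Defensive.

Import Order.TTheory GRing.Theory Num.Theory.
Import numFieldNormedType.Exports.

Local Open Scope classical_set_scope.
Local Open Scope ring_scope.
Local Open Scope quotient_scope.
Local Open Scope complex_scope.

Local Notation Re := (@complex.Re _).
Local Notation Im := (@complex.Im _).

(** * Integrals of trigonometric functions over the torus *)

(** The two norms live on different sides of the Fourier transform: [L2norm] is an integral,
    [Hmix_norm] a sum over coefficients. The upper bound must recover the integral of an arbitrary
    class from its coefficients, and this is the only use of completeness; the lower bound only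
    meets finite trigonometric sums.

    The weight is [mix_prod k] to the power [s], and this power is monotone, so both bounds reduce
    to counts free of [s]. If [Q] is the base of the power [s] in the target, the radius of the
    cross is [sqrt 2 ^ d / Q] for the upper bound and [1 / Q] for the lower one.

    The thresholds on [n] make [ln r] comparable with [ln n]: [27 ^ d <= n] gives [ln n >= 3 d],
    whence [ln r + d - 1 <= ln n]; and [n > (12 e^2) ^ d] says [ln n > d (2 + ln 12)], whence, from
    dimension two on, [ln r >= 2 / (2 + ln 12) * ln n]. *)

Section TrigIntegral.
Context {R : realType}.
Implicit Types (th : R).

Lemma is_derive_sin_affine th (k x : R) : k != 0 ->
  is_derive x 1 (fun t => k^-1 * sin (th + k * t)) (cos (th + k * x)).
Proof.
move=> k0.
have h : is_derive x 1 ((cst th : R -> R) + k \*: (id : R -> R)) (0 + k *: 1).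
  exact: is_deriveD.
have h2 := @is_derive1_comp R (@sin R) _ x _ _ _ h.
have h3 := is_deriveZ k^-1 (h2 _ (is_derive_sin _)).
apply: (is_derive_eq h3); rewrite add0r.
by rewrite -[LHS]/(k^-1 * (cos (th + k * x) * (k * 1))) mulr1 mulrC mulfK.
Qed.

Lemma circle_integralE (f : R -> R) :
  (@circle_measure R).-integrable setT (EFin \o f) ->
  (\int[@circle_measure R]_x (f x)%:E =
   \int[lebesgue_measure]_(x in `[0%R, (2 * pi)%R]) (f x)%:E)%E.
Proof.
move=> mf.
rewrite (@negligible_integral _ _ _ _ setT (~` (@circle_dom R)))//.
- rewrite setTD setCK; apply: eq_measure_integral => A mA AD.
  rewrite -[LHS]/(lebesgue_measure (A `&` circle_dom)); congr (_ _).
  exact: setIidl.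
- by apply: measurableC; exact: measurable_circle_dom.
- rewrite -[LHS]/(lebesgue_measure ((~` circle_dom) `&` circle_dom)).
  by rewrite setICl measure0.
Qed.

Lemma measurable_cos_affine th (k : R) :
  measurable_fun [set: measurableTypeR R] (fun x : R => cos (th + k * x)).
Proof.
apply: (@measurableT_comp _ _ _ _ _ _ (@cos R)).
  by apply: continuous_measurable_fun; exact: continuous_cos.
by apply: measurable_funD => //; apply: measurable_funM => //;
  exact: measurable_cst.
Qed.

Lemma finite_measure_bounded_integrable d (T : measurableType d)
    (mu : {finite_measure set T -> \bar R}) (f : T -> R) (M : R) :
  measurable_fun setT f -> (forall x, `|f x| <= M) ->
  mu.-integrable setT (EFin \o f).
Proof.
move=> mf fM; apply: (@le_integrable _ _ _ mu _ _ _ (EFin \o cst M)) => //.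
- exact/measurable_EFinP.
- by move=> x _ /=; rewrite lee_fin (le_trans (fM x))// ler_norm.
- exact: finite_measure_integrable_cst.
Qed.

Lemma sinD2pi_int th (k : int) : sin (th + k%:~R * (2 * pi)) = sin th :> R.
Proof.
case: k => n.
  have -> : n%:~R * (2 * pi) = (pi *+ 2) *+ n :> R by rewrite -pmulrn
    (mulr_natl pi) mulr_natl.
  by rewrite (periodicn (@sinD2pi R)).
rewrite -[in RHS](subrK (n.+1%:R * (2 * pi)) th) NegzE mulrNz mulNr -pmulrn.
have -> : n.+1%:R * (2 * pi) = (pi *+ 2) *+ n.+1 :> R by rewrite
  (mulr_natl pi) mulr_natl.
by rewrite (periodicn (@sinD2pi R)).
Qed.

Lemma circle_integral_cos th (k : int) :
  (\int[@circle_measure R]_x (cos (th + k%:~R * x))%:E =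
   (if k == 0 then 2 * pi * cos th else 0)%:E)%E.
Proof.
rewrite circle_integralE; last first.
  apply: (@finite_measure_bounded_integrable _ _ _ _ 1).
    exact: measurable_cos_affine.
  by move=> x; rewrite ler_norml cos_geN1 cos_le1.
have pi0 : 0 < 2 * pi :> R by rewrite mulr_gt0// pi_gt0.
have [->|k0] := eqVneq k 0.
  under eq_integral do rewrite mul0r addr0.
  rewrite integral_cst//= lebesgue_measure_itv/= lte_fin pi0 -EFinD subr0.
  by rewrite -EFinM mulrC.
have k0' : k%:~R != 0 :> R by rewrite intr_eq0.
have dF x := is_derive_sin_affine th x k0'.
pose F t : R := k%:~R^-1 * sin (th + k%:~R * t).
have cF : continuous F.
  by move=> x; apply: differentiable_continuous; apply/derivable1_diffP;
    case: (dF x).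
rewrite (@continuous_FTC2 _ _ F)//.
- by rewrite -EFinD /F sinD2pi_int mulr0 addr0 subrr.
- apply: continuous_subspaceT => x.
  apply: (@continuous_comp _ _ _ (fun x : R => th + k%:~R * x) (@cos R));
    last exact: continuous_cos.
  by apply: cvgD; [exact: cvg_cst|apply: cvgM; [exact: cvg_cst|exact: cvg_id]].
- split.
  + by move=> x _; case: (dF x).
  + by apply: cvg_at_right_filter; exact: cF.
  + by apply: cvg_at_left_filter; exact: cF.
- by move=> x _; rewrite derive1E; exact: derive_val.
Qed.

Lemma dotp_cons d (k0 : int) (k : d.-tuple int) (x0 : R)
    (x : d.-tuple (measurableTypeR R)) :
  dotp [tuple of k0 :: k]
    ([tuple of x0 :: x] : d.+1.-tuple (measurableTypeR R)) =
  k0%:~R * x0 + dotp k x.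
Proof.
rewrite /dotp big_ord_recl !tnth0; congr (_ + _).
by apply: eq_bigr => j _; rewrite !tnthS.
Qed.

Lemma measurable_dotp_fun d (k : d.-tuple int) :
  measurable_fun [set: d.-tuple (measurableTypeR R)] (@dotp R d k).
Proof.
rewrite (_ : dotp k = (fun x => - - dotp k x)); last first.
  by apply/funext => x; rewrite opprK.
by apply: measurableT_comp => //; exact: measurable_dotp.
Qed.

Lemma measurable_cos_dotpD d th (k : d.-tuple int) :
  measurable_fun [set: d.-tuple (measurableTypeR R)] (fun x =>
    cos (th + dotp k x)).
Proof.
apply: (@measurableT_comp _ _ _ _ _ _ (@cos R)).
  by apply: continuous_measurable_fun; exact: continuous_cos.
by apply: measurable_funD; [exact: measurable_cst|exact: measurable_dotp_fun].
Qed.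

Lemma integrable_cos_dotpD d th (k : d.-tuple int) :
  (@torus_measure R d).-integrable setT (EFin \o (fun x =>
    cos (th + dotp k x))).
Proof.
apply: (@finite_measure_bounded_integrable _ _ _ _ 1).
  exact: measurable_cos_dotpD.
by move=> x; rewrite ler_norml cos_geN1 cos_le1.
Qed.

(** Fubini for the recursively defined measure. Since all the measures are finite, the bound [M] is
    a convenient form of integrability. *)
Lemma torus_integralS d (f : d.+1.-tuple (measurableTypeR R) -> R) (M : R) :
  measurable_fun setT f -> (forall x, `|f x| <= M) ->
  (\int[@torus_measure R d.+1]_x (f x)%:E =
   \int[@circle_measure R]_t \int[@torus_measure R d]_x
     (f [tuple of t :: x])%:E)%E.
Proof.
move=> mf fM.
have mfc : measurable_fun setT (f \o @tuple_cons R d).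
  by apply: measurableT_comp => //; exact: measurable_tuple_cons.
have fin : ((@circle_measure R \x @torus_measure R d)%E setT < +oo)%E.
  rewrite -setXTT product_measure1E//.
  by apply: lte_mul_pinfty; rewrite ?ltey_eq ?fin_num_measure.
have ifc : (@circle_measure R \x @torus_measure R d)%E.-integrable setT
    (EFin \o (f \o @tuple_cons R d)).
  apply: (@le_integrable _ _ _ _ _ _ _ (EFin \o cst M)) => //.
  - exact/measurable_EFinP.
  - by move=> x _ /=; rewrite lee_fin (le_trans (fM _))// ler_norm.
  - apply/integrableP; split; first exact/measurable_EFinP.
    rewrite (_ : (fun x => _) = cst (`|M|%:E)); last by apply/funext.
    by rewrite integral_cst//; exact: lte_mul_pinfty.
rewrite -[LHS]/(\int[pushforward (circle_measure \x torus_measure d)%E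
  (@tuple_cons R d)]_x (f x)%:E)%E.
rewrite integral_pushforward//; last exact/measurable_EFinP.
by rewrite preimage_setT -(@integral12_prod_meas1 _ _ _ _ _ _ _ (EFin \o
  (f \o @tuple_cons R d))).
Qed.

(* The phase [th] carries the first coordinate through the induction on [d]. *)
Lemma torus_integral_cos d th (k : d.-tuple int) :
  (\int[@torus_measure R d]_x (cos (th + dotp k x))%:E =
   (if all (pred1 0) k then (2 * pi) ^+ d * cos th else 0)%:E)%E.
Proof.
elim: d k th => [|d IHd] k th.
  rewrite tuple0 /= mul1r.
  rewrite -[LHS]/(\int[dirac [tuple] ]_x (cos (th + dotp [tuple] x))%:E)%E.
  rewrite integral_dirac//; last by apply/measurable_EFinP;
    exact: measurable_cos_dotpD.
  by rewrite diracT mul1e /dotp big_ord0 addr0.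
rewrite (@torus_integralS _ _ 1); first last.
- by move=> x; rewrite ler_norml cos_geN1 cos_le1.
- exact: measurable_cos_dotpD.
case/tupleP: k => k0 k.
under eq_integral => t _.
  under eq_integral do rewrite dotp_cons addrA.
  rewrite IHd; over.
rewrite (_ : all _ [tuple of k0 :: k] = (k0 == 0) && all (pred1 0) k)//.
case: (all _ k); last first.
  by rewrite andbF integral0.
rewrite andbT; under eq_integral do rewrite EFinM.
rewrite integralZl//; last first.
  apply: (@finite_measure_bounded_integrable _ _ _ _ 1).
    exact: measurable_cos_affine.
  by move=> x; rewrite ler_norml cos_geN1 cos_le1.
rewrite circle_integral_cos -EFinM; case: ifP => _; last by rewrite mulr0.
by rewrite (exprSr _ d) (mulrA _ (2 * pi)).
Qed.

(** Pulls a null set of the circle back along one coordinate, which makes both the faces of the cube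
    and the hyperplanes [tnth x j = b] negligible. *)
Lemma torus_measure_coord d (j : 'I_d) (B : set (measurableTypeR R)) :
  measurable B -> @circle_measure R B = 0%E ->
  @torus_measure R d [set x | B (tnth x j)] = 0%E.
Proof.
move=> mB B0; elim: d j => [[]//|d IHd] j.
have h (A : set (d.+1.-tuple (measurableTypeR R))) (C : set (measurableTypeR R))
    (D : set (d.-tuple (measurableTypeR R))) :
    measurable C -> measurable D -> @tuple_cons R d @^-1` A = C `*` D ->
  @torus_measure R d.+1 A = (@circle_measure R C * @torus_measure R d D)%E.
  move=> mC mD; rewrite -[torus_measure d.+1 A]/((circle_measure \x
    torus_measure d)%E (@tuple_cons R d @^-1` A)) => ->.
  by rewrite product_measure1E.
case: (unliftP ord0 j) => [j'|] ->.
- rewrite (h _ setT [set x | B (tnth x j')])//.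
  + by rewrite IHd mule0.
  + rewrite (_ : mkset _ = (fun x => tnth x j') @^-1` B)//.
    by rewrite -[_ @^-1` _]setTI; apply: (@measurable_tnth _ _ _ j').
  + by apply/seteqP; split=> -[t x]; rewrite /= ?tnthS; tauto.
- rewrite (h _ B setT)//; first by rewrite B0 mul0e.
  by apply/seteqP; split=> -[t x]; rewrite /= ?tnth0; tauto.
Qed.

Lemma circle_measure_oo : @circle_measure R (~` `]0, 2 * pi[) = 0%E.
Proof.
rewrite -[LHS]/(lebesgue_measure ((~` `]0, 2 * pi[) `&` `[0, 2 * pi])).
apply: countable_lebesgue_measure0.
apply: (@sub_countable _ _ _ [set 0; 2 * pi]); last exact/finite_set_countable.
apply: subset_card_le => x /= [].
rewrite !in_itv /= => /negP; rewrite negb_and -!leNgt => /orP[h|h] /andP[h1 h2].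
  by left; apply/eqP; rewrite eq_le h h1.
by right; apply/eqP; rewrite eq_le h h2.
Qed.

(** The measure is defined on all tuples of reals, so membership in the cube is available only
    almost everywhere. The strict inequalities are what [cos_shift] asks for. *)
Lemma ae_torus_coord d (j : 'I_d) :
  {ae @torus_measure R d, forall x : d.-tuple (measurableTypeR R),
    0 < (tnth x j : R) < 2 * pi}.
Proof.
exists [set x | (~` `]0, 2 * pi[) (tnth x j)]; split.
- rewrite (_ : mkset _ = (fun x => tnth x j) @^-1` (~` `]0, 2 * pi[))//.
  rewrite -[_ @^-1` _]setTI; apply: (@measurable_tnth _ _ _ j) => //.
  by apply: measurableC; exact: measurable_itv.
- apply: torus_measure_coord; last exact: circle_measure_oo.
  by apply: measurableC; exact: measurable_itv.
- by move=> x /= h1 h2; apply: h1; move: h2; rewrite in_itv.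
Qed.
End TrigIntegral.

(** * Fourier sums *)

Section Basis.
Context {R : realType} (d : nat).
Local Notation point := (d.-tuple (measurableTypeR R)).
Local Notation mu := (@torus_measure R d).
Local Notation L2 := (@Defs.L2 R d).
Implicit Types (k l : d.-tuple int) (u v : L2) (a : R[i]).

Lemma integrable_mulrl (b : R) (h : point -> R) :
  mu.-integrable setT (EFin \o h) ->
  mu.-integrable setT (EFin \o (fun x => b * h x)).
Proof.
move=> ih; rewrite (_ : _ \o _ = (fun x => b%:E * (h x)%:E)%E)//.
exact: integrableZl.
Qed.

Lemma integrable_addr (g h : point -> R) :
  mu.-integrable setT (EFin \o g) -> mu.-integrable setT (EFin \o h) ->
  mu.-integrable setT (EFin \o (fun x => g x + h x)).
Proof.
move=> ig ih; apply: (@eq_integrable _ _ _ mu _ _ ((EFin \o g) \+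
  (EFin \o h))%E) => //.
exact: integrableD.
Qed.

Lemma torus_measureT : mu setT = ((2 * pi) ^+ d)%:E.
Proof.
have := @torus_integral_cos R d 0 [tuple 0 | j < d].
have -> : all (pred1 0) [tuple (0:int) | j < d].
  by apply/all_tnthP => j; rewrite tnth_mktuple.
rewrite cos0 mulr1 => <-.
rewrite (eq_integral (cst 1%E)) => [|x _];
  first by rewrite integral_cst// mul1e.
by rewrite /dotp big1 ?addr0 ?cos0// => j _; rewrite tnth_mktuple mul0r.
Qed.

Lemma bounded_square_integrable (f : point -> R[i]^o) (M : R) :
  measurable_fun [set: point] (fun x => Re (f x) : R) ->
  measurable_fun [set: point] (fun x => Im (f x) : R) ->
  (forall x, Normc.normc (f x) ^+ 2 <= M) -> f \in @square_integrable R d.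
Proof.
move=> mr mi fM; apply/asboolP; split=> //.
have /integrableP[_] := @finite_measure_bounded_integrable R _ _ mu _ M
  (measurable_normc2 mr mi) (fun x => eq_ind_r (fun y =>
    y <= M) (fM x) (ger0_norm (sqr_ge0 _))).
by under eq_integral do rewrite /= ger0_norm ?sqr_ge0//.
Qed.

Definition basis_scale : R := (2 * pi) `^ (- (d%:R / 2)).

Lemma basis_scale2 : basis_scale ^+ 2 * (2 * pi) ^+ d = 1.
Proof.
have pi0 : 0 < 2 * pi :> R by rewrite mulr_gt0// pi_gt0.
rewrite -powR_mulrn ?powR_ge0// -powRrM -powR_mulrn; last exact: ltW.
by rewrite -powRD ?(gt_eqF pi0) ?implybT// mulNr divfK// addNr powRr0.
Qed.

Definition basis_fun k : point -> R[i]^o :=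
  fun x => basis_scale%:C * expi (dotp k x).

Lemma normc_basis_fun k x : Normc.normc (basis_fun k x) ^+ 2 = basis_scale ^+ 2.
Proof.
rewrite normc2E /basis_fun /expi /= !mul0r subr0 addr0 !exprMn -mulrDr.
by rewrite cos2Dsin2 mulr1.
Qed.

Lemma basis_fun_sqint k : basis_fun k \in @square_integrable R d.
Proof.
apply: (@bounded_square_integrable _ (basis_scale ^+ 2)).
- rewrite (_ : (fun x => _) = (fun x => basis_scale * cos (dotp k x)));
  last first.
    by apply/funext => x; rewrite /basis_fun /expi /= mul0r subr0.
  apply: measurable_funM; first exact: measurable_cst.
  apply: (@measurableT_comp _ _ _ _ _ _ (@cos R));
    last exact: measurable_dotp_fun.
  by apply: continuous_measurable_fun; exact: continuous_cos.
- rewrite (_ : (fun x => _) = (fun x => basis_scale * sin (dotp k x)));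
  last first.
    by apply/funext => x; rewrite /basis_fun /expi /= mul0r addr0.
  apply: measurable_funM; first exact: measurable_cst.
  apply: (@measurableT_comp _ _ _ _ _ _ (@sin R));
    last exact: measurable_dotp_fun.
  by apply: continuous_measurable_fun; exact: continuous_sin.
- by move=> x; rewrite normc_basis_fun.
Qed.

Definition trig_basis k : L2 := \pi_L2 (SqFun (basis_fun_sqint k)).

Definition tsub k l : d.-tuple int := [tuple tnth k j - tnth l j | j < d].

Lemma dotp_sub k l x : dotp (tsub k l) x = dotp k x - dotp l x :> R.
Proof.
rewrite /dotp -sumrB; apply: eq_bigr => j _.
by rewrite tnth_mktuple rmorphB mulrBl.
Qed.

Lemma all_tsub k l : all (pred1 0) (tsub k l) = (k == l).
Proof.
apply/all_tnthP/eqP => [h|-> j]; last by rewrite tnth_mktuple subrr /=.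
by apply: eq_from_tnth => j; have := h j;
  rewrite tnth_mktuple /= subr_eq0 => /eqP.
Qed.

Lemma expiD (s t : R) : expi (s + t) = expi s * expi t.
Proof. by rewrite /expi cosD sinD [X in _ +i* X]addrC. Qed.

Lemma fourier_coef_basis l k : fourier_coef l (trig_basis k) = (l == k)%:R.
Proof.
rewrite /trig_basis fourier_coef_pi /= -/basis_scale.
have E x : basis_fun k x * expi (- dotp l x) =
  basis_scale%:C * expi (dotp (tsub k l) x).
  by rewrite /basis_fun -mulrA dotp_sub expiD.
have icos th : mu.-integrable setT (EFin \o (fun x =>
  cos (th + dotp (tsub k l) x))).
  exact: integrable_cos_dotpD.
have intE th : \int[mu]_x (basis_scale * cos (th + dotp (tsub k l) x)) =
    basis_scale * (if k == l then (2 * pi) ^+ d * cos th else 0).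
  by rewrite RintegralZl// /Rintegral torus_integral_cos all_tsub.
rewrite /complex_integral.
under eq_Rintegral do rewrite E /expi /= mul0r subr0 -[dotp _ _]add0r.
(* The sine is a cosine of phase [- pi / 2], so one integral formula serves both the real and the
   imaginary part. *)
under [X in _ +i* X]eq_Rintegral do
  rewrite E /expi /= mul0r addr0 -cosBpihalf addrC.
rewrite !intE cos0 cosN cos_pihalf mulr0 mulr1 if_same mulr0.
rewrite (eq_sym l); case: eqVneq => _; last by rewrite mulr0 mulr0.
apply/eqP; rewrite eq_complex /= !mul0r !mulr0 subr0 addr0 eqxx andbT.
by rewrite mulrA -expr2 basis_scale2.
Qed.

Definition L2norm2 u : R := L2norm u ^+ 2.

Lemma L2norm2E u : L2norm2 u = \int[mu]_x (Normc.normc (repr u x) ^+ 2).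
Proof.
by rewrite /L2norm2 /L2norm sqr_sqrtr// Rintegral_ge0// => x _; exact: sqr_ge0.
Qed.

Lemma L2norm2_pi (f : sqfun d) :
  L2norm2 (\pi_L2 f) = \int[mu]_x (Normc.normc (f x) ^+ 2).
Proof.
by rewrite /L2norm2 L2norm_pi sqr_sqrtr// Rintegral_ge0// => x _;
  exact: sqr_ge0.
Qed.

(** No inner product is introduced: every Pythagorean identity below comes from iterating this
    expansion. *)
Lemma L2norm2_add_basis u a k :
  L2norm2 (u + a *: trig_basis k) = L2norm2 u +
    2 * (Re a * Re (fourier_coef k u) + Im a * Im (fourier_coef k u)) +
    Normc.normc a ^+ 2.
Proof.
have -> : u + a *: trig_basis k =
  \pi_L2 (repr u + a *: SqFun (basis_fun_sqint k)).
  by rewrite L2_piD -L2_scale_pi reprK.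
rewrite L2norm2_pi L2norm2E /fourier_coef -/basis_scale.
set f : sqfun d := repr u.
pose p x : R := Re (f x * expi (- dotp k x)).
pose q x : R := Im (f x * expi (- dotp k x)).
have ip : mu.-integrable setT (EFin \o p) by exact: Re_integrable.
have iq : mu.-integrable setT (EFin \o q) by exact: Im_integrable.
rewrite -[complex_integral _]/(Rintegral mu setT p +i* Rintegral mu setT q).
rewrite /= !mul0r subr0 addr0.
pose C := basis_scale; rewrite -/C.
have E x : Normc.normc ((f + a *: SqFun (basis_fun_sqint k)) x) ^+ 2 =
    Normc.normc (f x) ^+ 2 + (2 * C * Re a * p x +
      (2 * C * Im a * q x + Normc.normc a ^+ 2 * C ^+ 2)).
  rewrite -[(f + _) x]/(f x + a * (C%:C * expi (dotp k x))).
  rewrite /p /q !normc2E /expi cosN sinN.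
  have := cos2Dsin2 (dotp k x); move: (cos _) (sin _) => c s cs.
  case: (f x) => f1 f2; case: (a) => a1 a2 /=.
  rewrite !(mul0r, subr0, addr0).
  (* Inserting [c ^ 2 + s ^ 2 = 1] turns the claim into a polynomial identity. *)
  have -> : C ^+ 2 = C ^+ 2 * (c ^+ 2 + s ^+ 2) by rewrite cs mulr1.
  ring.
pose c := Normc.normc a ^+ 2 * C ^+ 2; rewrite -/c in E.
pose N x := Normc.normc (f x) ^+ 2.
transitivity (\int[mu]_x (N x + (2 * C * Re a * p x +
    (2 * C * Im a * q x + c)))).
  by apply: eq_Rintegral => x _; exact: E.
have iN : mu.-integrable setT (EFin \o N) by exact: sqfun_normc2_integrable.
have ic : mu.-integrable setT (EFin \o cst c).
  exact: finite_measure_integrable_cst.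
have ip' := integrable_mulrl (2 * C * Re a) ip.
have iq' := integrable_mulrl (2 * C * Im a) iq.
have iqc := integrable_addr iq' ic.
rewrite RintegralD//; last exact: integrable_addr.
rewrite RintegralD// RintegralD// (RintegralZl _ _ ip)// (RintegralZl _ _ iq)//.
rewrite (_ : \int[mu]_x cst c x = c * (2 * pi) ^+ d); last first.
  by rewrite Rintegral_cst// [X in fine X](torus_measureT).
rewrite -[RHS]addrA; congr (_ + _).
have -> : c * (2 * pi) ^+ d = Normc.normc a ^+ 2.
  by rewrite /c -mulrA basis_scale2 mulr1.
ring.
Qed.
Local Notation nc2 z := (Normc.normc z ^+ 2).

Lemma fourier_coefD k u v : fourier_coef k (u + v) =
  fourier_coef k u + fourier_coef k v.
Proof. by rewrite -[u]scale1r fourier_coef_linear scale1r mul1r. Qed.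

Lemma fourier_coef0 k : fourier_coef k (0 : L2) = 0.
Proof.
have /eqP := fourier_coefD k 0 0.
by rewrite addr0 -subr_eq subrr eq_sym => /eqP.
Qed.

Lemma fourier_coefZ k a u : fourier_coef k (a *: u) = a * fourier_coef k u.
Proof. by rewrite -[a *: u]addr0 fourier_coef_linear fourier_coef0 addr0. Qed.

Lemma fourier_coefB k u v : fourier_coef k (u - v) =
  fourier_coef k u - fourier_coef k v.
Proof. by rewrite fourier_coefD -scaleN1r fourier_coefZ mulN1r. Qed.

Lemma fourier_coef_sum k (I : eqType) (s : seq I) (F : I -> L2) :
  fourier_coef k (\sum_(i <- s) F i) = \sum_(i <- s) fourier_coef k (F i).
Proof.
exact: (big_morph _ (fourier_coefD k) (fourier_coef0 k)).
Qed.

Definition trig_sum (s : seq (d.-tuple int)) (t : d.-tuple int -> R[i]) : L2 :=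
  \sum_(k <- s) t k *: trig_basis k.

Lemma fourier_coef_trig_sum l s t : uniq s ->
  fourier_coef l (trig_sum s t) = if l \in s then t l else 0.
Proof.
move=> us; rewrite /trig_sum fourier_coef_sum.
under eq_bigr do rewrite fourier_coefZ fourier_coef_basis.
case: ifPn => [ls|lns].
  rewrite (bigD1_seq l)//= eqxx mulr1 big1 ?addr0// => i il.
  by rewrite eq_sym (negbTE il) mulr0.
rewrite big1_seq// => i /= si; case: eqVneq => [li|]; last by rewrite mulr0.
by rewrite li si in lns.
Qed.

(** Completing the square in one coefficient after another: the Fourier coefficients are the optimal
    [t], and any other choice pays its squared deviation. The optimal [t] gives Bessel's identity,
    and [u = 0] the norm of a trigonometric sum. *)
Lemma L2norm2_sub_trig_sum s t u : uniq s ->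
  L2norm2 (u - trig_sum s t) = L2norm2 u - \sum_(k <- s) nc2 (fourier_coef k u)
    + \sum_(k <- s) nc2 (fourier_coef k u - t k).
Proof.
elim: s => [_|k s IHs /andP[ks us]].
  by rewrite /trig_sum !big_nil !subr0 addr0.
have -> : u - trig_sum (k :: s) t =
  (u - trig_sum s t) + (- t k) *: trig_basis k.
  by rewrite /trig_sum big_cons opprD addrA addrAC scaleNr.
rewrite L2norm2_add_basis IHs// !big_cons.
rewrite fourier_coefB fourier_coef_trig_sum// (negbTE ks) subr0.
move: (\sum_(_ <- _) _) (\sum_(_ <- _) _) => S1 S2.
move: (fourier_coef k u) (t k) => [c1 c2] [t1 t2].
by rewrite !normc2E /=; ring.
Qed.

Definition trig_proj s u := trig_sum s (fun k => fourier_coef k u).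

Lemma L2norm2_sub_proj s u : uniq s ->
  L2norm2 (u - trig_proj s u) = L2norm2 u - \sum_(k <- s) nc2
    (fourier_coef k u).
Proof.
move=> us; rewrite L2norm2_sub_trig_sum// [X in _ + X]big1 ?addr0// => k _.
by rewrite subrr normc2E /= expr0n addr0.
Qed.

Lemma L2norm2_0 : L2norm2 (0 : L2) = 0.
Proof.
have -> : (0 : L2) = \pi_(Defs.L2 d) (0 *: repr (0 : L2)).
  by rewrite -L2_scale_pi reprK -[LHS](scale0r (0 : L2)).
rewrite L2norm2_pi (@eq_Rintegral _ _ _ mu _
  (cst 0)) ?Rintegral_cst ?mul0r// => x _.
by rewrite -[X in Normc.normc X]/(0 * repr (0 :
  L2) x) mul0r normc2E /= expr0n addr0.
Qed.

Lemma L2norm2_trig_sum s t : uniq s ->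
  L2norm2 (trig_sum s t) = \sum_(k <- s) nc2 (t k).
Proof.
move=> us; have -> : trig_sum s t = 0 - trig_sum s (fun k => - t k).
  by rewrite /trig_sum sub0r -sumrN; apply: eq_bigr => k _;
    rewrite scaleNr opprK.
rewrite L2norm2_sub_trig_sum// L2norm2_0 big1 => [|k _]; last first.
  by rewrite fourier_coef0 normc2E /= expr0n addr0.
rewrite subrr add0r; apply: eq_bigr => k _.
by rewrite fourier_coef0 sub0r opprK.
Qed.

(** Stands in for the triangle inequality. It integrates a pointwise bound, and the factors 2 are
    harmless where only smallness matters. *)
Lemma L2norm2D_le a u v :
  L2norm2 (a *: u + v) <= 2 * nc2 a * L2norm2 u + 2 * L2norm2 v.
Proof.
have iN (w : L2) : mu.-integrable setT (EFin \o (fun x => nc2 (repr w x))).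
  exact: sqfun_normc2_integrable.
have i1 := integrable_mulrl (2 * nc2 a) (iN u).
have i2 := integrable_mulrl 2 (iN v).
rewrite !L2norm2E -!RintegralZl// -RintegralD//.
have -> : a *: u + v = \pi_(Defs.L2 d) (a *: repr u + repr v).
  by rewrite L2_piD -L2_scale_pi !reprK.
rewrite -L2norm2E L2norm2_pi; apply: le_Rintegral => //.
- exact: sqfun_normc2_integrable.
- exact: integrable_addr.
- by move=> x _; exact: normc2_scale.
Qed.

Lemma trig_projD s (u v : L2) : trig_proj s (u + v) =
  trig_proj s u + trig_proj s v.
Proof.
rewrite /trig_proj /trig_sum -big_split; apply: eq_bigr => k _ /=.
by rewrite fourier_coefD scalerDl.
Qed.

Lemma trig_projZ s a (u : L2) : trig_proj s (a *: u) = a *: trig_proj s u.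
Proof.
rewrite /trig_proj /trig_sum scaler_sumr; apply: eq_bigr => k _ /=.
by rewrite fourier_coefZ scalerA.
Qed.

Lemma ler_sum_uniq_sub (I : eqType) (s t : seq I) (F : I -> R) :
  uniq s -> uniq t -> {subset s <= t} -> (forall i, 0 <= F i) ->
  \sum_(i <- s) F i <= \sum_(i <- t) F i.
Proof.
move=> us ut st F0; rewrite [leRHS](bigID (mem s))/=.
rewrite -[leLHS]addr0 lerD ?sumr_ge0//.
rewrite -[leRHS]big_filter le_eqVlt; apply/orP; left; apply/eqP.
apply: perm_big; apply: uniq_perm => //; first exact: filter_uniq.
by move=> i; rewrite mem_filter; case: (boolP (i \in s)) => // /st ->.
Qed.

Lemma L2norm2_sub_proj_le s t u : uniq s -> uniq t -> {subset s <= t} ->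
  L2norm2 (u - trig_proj t u) <= L2norm2 (u - trig_proj s u).
Proof.
move=> us ut st; rewrite !L2norm2_sub_proj// lerD2l lerN2.
by apply: ler_sum_uniq_sub => // i; exact: sqr_ge0.
Qed.

(* The partial Fourier sums are the best approximations and improve when [s]
   grows, so this is membership in the closure of the trigonometric polynomials. *)
Definition trig_approx u := forall e : R, 0 < e ->
  exists2 s, uniq s & L2norm2 (u - trig_proj s u) <= e.

Lemma trig_approxP a u v : trig_approx u -> trig_approx v ->
  trig_approx (a *: u + v).
Proof.
move=> hu hv e e0.
have a0 : 0 < 2 * nc2 a + 2 by rewrite ltr_wpDl// mulr_ge0// sqr_ge0.
(* The tolerance is divided by the sum of the two factors in [L2norm2D_le]. *)
have [|s us hs] := hu (e / (2 * nc2 a + 2)); first by rewrite divr_gt0.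
have [|t ut ht] := hv (e / (2 * nc2 a + 2)); first by rewrite divr_gt0.
exists (undup (s ++ t)); first exact: undup_uniq.
set r := undup _.
have -> : a *: u + v - trig_proj r (a *: u + v) =
    a *: (u - trig_proj r u) + (v - trig_proj r v).
  by rewrite trig_projD trig_projZ scalerBr opprD addrACA.
have hu' : L2norm2 (u - trig_proj r u) <= e / (2 * nc2 a + 2).
  apply: le_trans hs; apply: L2norm2_sub_proj_le; rewrite ?undup_uniq// => i si.
  by rewrite mem_undup mem_cat si.
have hv' : L2norm2 (v - trig_proj r v) <= e / (2 * nc2 a + 2).
  apply: le_trans ht; apply: L2norm2_sub_proj_le; rewrite ?undup_uniq// => i si.
  by rewrite mem_undup mem_cat si orbT.
apply: (le_trans (L2norm2D_le _ _ _)).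
have -> : e = 2 * nc2 a * (e / (2 * nc2 a + 2)) + 2 * (e / (2 * nc2 a + 2)).
  by rewrite -mulrDl mulrC divfK// gt_eqF.
have a20 : 0 <= 2 * nc2 a by rewrite mulr_ge0// sqr_ge0.
move: hu' hv'; move: (L2norm2 _) (L2norm2 _) (e / _) => x y z xz yz.
by rewrite lerD// ler_wpM2l.
Qed.

Lemma trig_approx_closure u :
  (forall e : R, 0 < e -> exists2 v, trig_approx v & L2norm2 (u - v) <= e) ->
  trig_approx u.
Proof.
move=> h e e0; have e4 : 0 < e / 4 by rewrite divr_gt0.
have [v /(_ _ e4)[s us hs] hv] := h _ e4.
exists s => //.
(* Removing its projection does not increase the norm of [u - v]. The two errors thus obtained are
   each at most [e / 4] and enter with factor 2. *)
have -> : u - trig_proj s u = 1 *: ((u - v) - trig_proj s (u - v)) +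
  (v - trig_proj s v).
  rewrite scale1r addrACA subrK -opprD -trig_projD subrK //.
apply: (le_trans (L2norm2D_le _ _ _)).
have : L2norm2 (u - v - trig_proj s (u - v)) <= e / 4.
  rewrite L2norm2_sub_proj// (le_trans _ hv)// lerBlDr lerDl.
  by apply: sumr_ge0 => i _; exact: sqr_ge0.
have -> : nc2 (1 : R[i]) = 1 by rewrite normc2E /= expr1n expr0n addr0.
move: hs; move: (L2norm2 (_ - _)) (L2norm2 (_ - trig_proj s (u - v))) =>
  x y xe ye.
by clear -xe ye; lra.
Qed.

Lemma trig_approx_basis k : trig_approx (trig_basis k).
Proof.
move=> e e0; exists [:: k] => //.
rewrite /trig_proj /trig_sum big_seq1 fourier_coef_basis eqxx scale1r subrr.
by rewrite L2norm2_0 ltW.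
Qed.

Lemma parseval_le u : trig_approx u ->
  ((L2norm2 u)%:E <= \esum_(k in [set: d.-tuple int]) (nc2
    (fourier_coef k u))%:E)%E.
Proof.
move=> h; apply/lee_addgt0Pr => e e0; have [s us hs] := h _ e0.
rewrite L2norm2_sub_proj// in hs.
apply: (@le_trans _ _ ((\sum_(k <- s) nc2 (fourier_coef k u))%:E + e%:E)%E).
  by rewrite -EFinD lee_fin -lerBlDl.
rewrite leeD2r//; apply: esum_ge; exists [set` s] => //.
  by split=> //; exact: finite_seq.
by rewrite -fsbig_seq// sumEFin.
Qed.
End Basis.

(** * Completeness of the trigonometric system *)

Section Density.
Context {R : realType} (d : nat).
Local Notation point := (d.-tuple (measurableTypeR R)).
Local Notation mu := (@torus_measure R d).
Local Notation L2 := (@Defs.L2 R d).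
Local Notation sqint := (@square_integrable R d).
Local Notation nc2 z := (Normc.normc z ^+ 2).
Implicit Types (f g : point -> R[i]^o).

(** Membership in [sqint] is hidden under an existential, so that the predicate depends on the
    function alone and can be transported along pointwise equalities. *)
Definition fun_approx f := exists h : f \in sqint,
  trig_approx (\pi_L2 (SqFun h)).

Lemma L2_piZ (a : R[i]) (f : sqfun d) : \pi_L2 (a *: f) = a *: (\pi_L2 f : L2).
Proof. by rewrite -L2_scale_pi. Qed.

Lemma fun_approxP (a : R[i]) f g :
  fun_approx f -> fun_approx g -> fun_approx (fun x => a * f x + g x).
Proof.
move=> [hf af] [hg ag].
have hfg := (@square_integrable_submod R d).2 a f g hf hg.
pose u : L2 := \pi_L2 (SqFun hf); pose v : L2 := \pi_L2 (SqFun hg).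
exists hfg; have -> : \pi_L2 (SqFun hfg) = a *: u + v.
  rewrite -L2_piZ -L2_piD; congr (\pi_L2 _); exact: val_inj.
exact (@trig_approxP R d a u v af ag).
Qed.

Lemma fun_approx0 : fun_approx (fun=> 0).
Proof.
exists (rpred0 _); rewrite (_ : SqFun _ = 0); last exact: val_inj.
rewrite -[X in \pi_L2 X](scale0r (0 : sqfun d)) L2_piZ scale0r.
by move=> e e0; exists [::] => //;
  rewrite /trig_proj /trig_sum big_nil subr0 L2norm2_0 ltW.
Qed.

Lemma fun_approx_closure f : f \in sqint ->
  (forall e : R, 0 < e -> exists2 g, fun_approx g &
    \int[mu]_x nc2 (f x - g x) <= e) -> fun_approx f.
Proof.
move=> hf h; exists hf; apply: trig_approx_closure => e /h[g [hg ag] fg].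
exists (\pi_L2 (SqFun hg)) => //.
rewrite -scaleN1r addrC -L2_piZ -L2_piD L2norm2_pi.
apply: le_trans fg; rewrite le_eqVlt; apply/orP; left; apply/eqP.
by apply: eq_Rintegral => x _; congr (Normc.normc _ ^+ 2);
  rewrite /= addrC scaleN1r.
Qed.

Lemma normc2_real (r : R) : nc2 (r%:C) = r ^+ 2.
Proof. by rewrite normc2E /= expr0n addr0. Qed.

(** Dominated convergence applied to the squared errors: their integrals tend to 0, so some [g N] is
    close to [f] in mean square. *)
Lemma fun_approx_cvg (g : nat -> point -> R) (f G : point -> R) :
  (forall n, fun_approx (fun x => (g n x)%:C)) ->
  (fun x => (f x)%:C) \in sqint -> mu.-integrable setT (EFin \o G) ->
  {ae mu, forall x, g ^~ x @ \oo --> f x} ->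
  (forall n x, (g n x - f x) ^+ 2 <= G x) ->
  fun_approx (fun x => (f x)%:C).
Proof.
move=> ag hf iG gf gG; apply: fun_approx_closure => // e e0.
have mf : measurable_fun setT f by move: hf => /asboolP[].
have mg n : measurable_fun setT (g n) by have [hg _] := ag n;
  move: hg => /asboolP[].
pose h n x := ((g n x - f x) ^+ 2)%:E.
have mh n : measurable_fun setT (h n).
  by apply/measurable_EFinP; apply: measurable_funX; exact: measurable_funB.
have hcvg : {ae mu, forall x, setT x -> h ^~ x @ \oo --> (cst 0%E) x}.
  apply: filterS gf => x gfx _.
  have : (fun n => (g n x - f x) * (g n x - f x)) @ \oo --> (f x - f x) *
    (f x - f x).
    by apply: cvgM; apply: cvgB => //; exact: cvg_cst.
  rewrite subrr mul0r => gf0; apply/fine_cvgP; split; first by near=> n.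
  by apply: cvg_trans gf0; apply: near_eq_cvg; near=> n; rewrite /= expr2.
have hG : {ae mu, forall x n, setT x -> (`|h n x| <= (EFin \o G) x)%E}.
  by apply: aeW => x n _; rewrite lee_fin ger0_norm// sqr_ge0.
have [_ _] := dominated_convergence measurableT mh
  (measurable_cst _) hcvg iG hG.
rewrite integral0 => /fine_cvgP[_ /cvgrPdist_le /(_ _ e0)[N _ /(_ N
  (leqnn N))]].
rewrite sub0r normrN ger0_norm; last first.
  by apply: fine_ge0; apply: integral_ge0 => x _; rewrite lee_fin sqr_ge0.
move=> le; exists (fun x => (g N x)%:C) => //.
apply: le_trans le; rewrite le_eqVlt; apply/orP; left; apply/eqP.
rewrite /Rintegral; congr fine; apply: eq_integral => x _.
by rewrite -rmorphB normc2_real -sqrrN opprB.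
Unshelve. all: by end_near. Qed.

(** Actual functions rather than classes in [L2], so that products and powers can be formed. *)
Inductive trig_poly : (point -> R[i]) -> Prop :=
| trig_poly0 : trig_poly (fun=> 0)
| trig_poly_cons (a : R[i]) (k : d.-tuple int) (f : point -> R[i]) :
    trig_poly f -> trig_poly (fun x => a * expi (dotp k x) + f x).

Lemma trig_poly_ext (f g : point -> R[i]) : f =1 g -> trig_poly f ->
  trig_poly g.
Proof. by move=> /funext ->. Qed.

Lemma trig_polyD (f g : point -> R[i]) :
  trig_poly f -> trig_poly g -> trig_poly (fun x => f x + g x).
Proof.
move=> tf tg; elim: tf => [|a k h _ IH].
  by apply: trig_poly_ext tg => x; rewrite add0r.
by apply: trig_poly_ext (trig_poly_cons a k IH) => x; rewrite addrA.
Qed.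

Definition tadd (k l : d.-tuple int) : d.-tuple int :=
  [tuple tnth k j + tnth l j | j < d].

Lemma dotp_add k l x : dotp (tadd k l) x = dotp k x + dotp l x :> R.
Proof.
rewrite /dotp -big_split; apply: eq_bigr => j _ /=.
by rewrite tnth_mktuple rmorphD mulrDl.
Qed.

Lemma trig_polyM (f g : point -> R[i]) :
  trig_poly f -> trig_poly g -> trig_poly (fun x => f x * g x).
Proof.
move=> tf tg; elim: tf => [|a k h _ IH].
  by apply: trig_poly_ext trig_poly0 => x; rewrite mul0r.
have : trig_poly (fun x => a * expi (dotp k x) * g x).
  elim: tg => [|b l h' _ IH'].
    by apply: trig_poly_ext trig_poly0 => x; rewrite mulr0.
  apply: trig_poly_ext (trig_poly_cons (a * b) (tadd k l) IH') => x.
  by rewrite dotp_add expiD mulrDr mulrACA.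
move=> /trig_polyD /(_ IH); apply: trig_poly_ext => x.
by rewrite mulrDl.
Qed.

Lemma trig_poly_cst (a : R[i]) : trig_poly (fun=> a).
Proof.
apply: trig_poly_ext (trig_poly_cons a [tuple 0 | j < d] trig_poly0) => x.
rewrite addr0 /dotp big1 => [|j _]; last by rewrite tnth_mktuple mul0r.
by rewrite /expi cos0 sin0 mulr1.
Qed.

Lemma trig_polyX (f : point -> R[i]) n : trig_poly f ->
  trig_poly (fun x => f x ^+ n).
Proof.
move=> tf; elim: n => [|n IH]; first exact: trig_poly_cst.
by apply: trig_poly_ext (trig_polyM tf IH) => x; rewrite exprS.
Qed.

Lemma basis_scale_neq0 : @basis_scale R d != 0.
Proof. by rewrite gt_eqF// powR_gt0// mulr_gt0// pi_gt0. Qed.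

Lemma trig_poly_approx f : trig_poly f -> fun_approx f.
Proof.
elim=> [|a k g _ IH]; first exact: fun_approx0.
have ek : fun_approx (basis_fun k) by exists (basis_fun_sqint k);
  exact: trig_approx_basis.
have := fun_approxP (a / (@basis_scale R d)%:C) ek IH.
congr fun_approx; apply/funext => x; congr (_ + _).
rewrite /basis_fun mulrA divfK//.
by rewrite (inj_eq (@complexI _)) basis_scale_neq0.
Qed.

Lemma bernoulli_lower (t : R) n : 0 <= t <= 1 -> 1 - n%:R * t <= (1 - t) ^+ n.
Proof.
move=> /andP[t0 t1]; elim: n => [|n IH]; first by rewrite mul0r subr0 expr0.
have := ler_wpM2l (_ : 0 <= 1 - t) IH; rewrite subr_ge0 => /(_ t1);
  rewrite -exprS.
apply: le_trans; rewrite -natr1; have := ler0n R n; move: n%:R => m m0.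
nra.
Qed.

(** Each factor [1 - t] compensates one increment: [(1 - t) (1 + (n + 1) t) <= 1 + n t]. *)
Lemma bernoulli_upper (t : R) n : 0 <= t <= 1 ->
  (1 - t) ^+ n * (1 + n%:R * t) <= 1.
Proof.
move=> /andP[t0 t1]; elim: n => [|n IH]; first by rewrite mul0r addr0 mulr1.
apply: le_trans IH; rewrite exprSr -mulrA.
apply: ler_wpM2l; first by rewrite exprn_ge0// subr_ge0.
rewrite -natr1; have := ler0n R n; move: n%:R => m m0; nra.
Qed.

(** [(1 - y^m)^(2^m)] behaves like [exp (- (2 y)^m)], whose limit drops from 1 to 0 at [y = 1 / 2].
    The Bernoulli bounds at [t = y^m] squeeze it between [1 - (2 y)^m] and 1 below the jump, between
    0 and [(2 y)^(-m)] above it. *)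
Lemma step_cvg (y : R) : 0 <= y <= 1 -> y != 1 / 2 ->
  (fun m => (1 - y ^+ m) ^+ (2 ^ m)) @ \oo --> ((y < 1 / 2)%R%:R : R).
Proof.
move=> /andP[y0 y1] y2; have [yl|yg] := ltP y (1 / 2) => /=.
  have cv : (fun m => 1 - (2 * y) ^+ m) @ \oo --> (1 - 0 : R).
    by apply: cvgB; [exact: cvg_cst|apply: cvg_expr; rewrite ger0_norm; lra].
  rewrite subr0 in cv; 
  apply: (@squeeze_cvgr _ _ _ _ (fun m =>
    1 - (2 * y) ^+ m) (cst 1) _ _ 1 _ _) => //; last exact: cvg_cst.
  near=> m; have ym : 0 <= y ^+ m <= 1 by rewrite exprn_ge0 ?exprn_ile1.
  rewrite exprMn -natrX bernoulli_lower//=.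
  by rewrite exprn_ile1// ?subr_ge0 ?lerBlDr ?lerDl; case/andP: ym.
have yg' : 1 / 2 < y by rewrite lt_neqAle eq_sym y2.
have y20 : 0 < 2 * y by lra.
have cv : (fun m => (2 * y)^-1 ^+ m) @ \oo --> (0 : R).
  apply: cvg_expr; rewrite ger0_norm ?invr_ge0 ?(ltW y20)// invf_lt1//; lra.
apply: (@squeeze_cvgr _ _ _ _ (cst 0) (fun m => (2 * y)^-1 ^+ m) _ _ 0 _ _) =>
  //; last exact: cvg_cst.
near=> m; have ym : 0 <= y ^+ m <= 1 by rewrite exprn_ge0 ?exprn_ile1.
rewrite exprn_ge0 ?subr_ge0; last by case/andP: ym.
have := bernoulli_upper (2 ^ m) ym; rewrite natrX -exprMn => le1.
rewrite exprVn -[leRHS]mul1r ler_pdivlMr ?exprn_gt0//.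
apply: le_trans le1; rewrite ler_wpM2l ?lerDr// exprn_ge0// subr_ge0.
by case/andP: ym.
Unshelve. all: by end_near. Qed.

(** Discards the hyperplane on which the step polynomials take [y = 1 / 2], the value excluded in
    [step_cvg]. *)
Lemma ae_torus_coord_neq (j : 'I_d) (b : R) :
  {ae mu, forall x : point, (tnth x j : R) != b}.
Proof.
exists [set x | [set b] (tnth x j)]; split.
- rewrite (_ : mkset _ = (fun x => tnth x j) @^-1` [set b])//.
  by rewrite -[_ @^-1` _]setTI; apply: (@measurable_tnth _ _ _ j).
- apply: torus_measure_coord => //; apply/eqP; rewrite eq_le measure_ge0 andbT.
  rewrite -[circle_measure _]/(lebesgue_measure ([set b] `&` circle_dom)).
  rewrite -(lebesgue_measure_set1 b) le_measure ?inE//.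
  by apply: measurableI => //; exact: measurable_circle_dom.
- by move=> x /= /negP; rewrite negbK => /eqP.
Qed.

(** Turns the condition [t < b] into a comparison of cosines, which trigonometric polynomials can
    express. *)
Lemma cos_shift (b t : R) : 0 < b < 2 * pi -> 0 < t < 2 * pi -> t != b ->
  (cos (b / 2) < cos (t - b / 2)) = (t < b) /\
  cos (t - b / 2) != cos (b / 2).
Proof.
move=> /andP[b0 b1] /andP[t0 t1] tb; have pi0 := pi_gt0 R.
have hb : b / 2 \in `[0, pi] by rewrite in_itv /=; apply/andP; split; lra.
(* [u] is the distance from [t] to [b / 2] on the circle. It lies in [[0, pi]], where the cosine is
   strictly decreasing, and [b / 2] is the centre of the interval from 0 to [b]. *)
have [u [hu -> [hlt uneq]]] : exists u, [/\ u \in `[0, pi],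
    cos (t - b / 2) = cos u & (u < b / 2) = (t < b) /\ u != b / 2].
  have [h|h] := leP (t - b / 2) 0.
    exists (- (t - b / 2)); rewrite cosN; split=> //.
      by rewrite in_itv /=; apply/andP; split; lra.
    by split; [apply/idP/idP => ?; lra|lra].
  have [h'|h'] := leP (t - b / 2) pi.
    exists (t - b / 2); split=> //.
      by rewrite in_itv /=; apply/andP; split; lra.
    by split; [apply/idP/idP => ?; lra|lra].
  exists (2 * pi - (t - b / 2)); split.
  - by rewrite in_itv /=; apply/andP; split; lra.
  - by rewrite -(cosN (t - _)) -(@cosD2pi R) addrC mulr_natl.
  - by split; [apply/idP/idP => ?; lra|lra].
rewrite ltr_cos// hlt; split=> //; apply: contra uneq => /eqP.
by move/cos_inj => ->.
Qed.

Lemma dotp_unit (j : 'I_d) (z : int) (x : point) :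
  dotp [tuple if i == j then z else 0 | i < d] x = z%:~R * (tnth x j : R).
Proof.
rewrite /dotp (bigD1 j)//= tnth_mktuple eqxx big1 ?addr0// => i ij.
by rewrite tnth_mktuple (negbTE ij) mul0r.
Qed.

Lemma trig_poly_cos (j : 'I_d) (c : R) :
  trig_poly (fun x => (cos ((tnth x j : R) - c))%:C).
Proof.
have h := trig_poly_cons (2^-1%:C * expi
  (- c)) [tuple if i == j then 1 else 0 | i < d]
  (trig_poly_cons (2^-1%:C * expi c) [tuple if i == j then -1 else 0 | i < d]
    trig_poly0).
apply: trig_poly_ext h => x; rewrite addr0 !dotp_unit mul1r mulN1r -!mulrA
  -!expiD.
rewrite (addrC (- c)) -(opprB _ c).
set t := _ - c; rewrite -mulrDr.
apply/eqP; rewrite eq_complex /= cosN sinN subrr !mul0r subr0 mulr0 addr0 eqxx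
  andbT.
apply/eqP; lra.
Qed.

Lemma trig_polyBZ (a b : R) (f : point -> R) : trig_poly (fun x => (f x)%:C) ->
  trig_poly (fun x => (a + b * f x)%:C).
Proof.
move=> tf; have := trig_polyD (trig_poly_cst a%:C) (trig_polyM
  (trig_poly_cst b%:C) tf).
by apply: trig_poly_ext => x; rewrite rmorphD rmorphM.
Qed.

Lemma trig_polyXr (f : point -> R) n : trig_poly (fun x => (f x)%:C) ->
  trig_poly (fun x => (f x ^+ n)%:C).
Proof.
by move=> tf; apply: trig_poly_ext (trig_polyX n tf) => x; rewrite rmorphXn.
Qed.

(* The bound by 1 makes this class of sets stable under intersection. *)
Definition poly_limit (A : set point) := measurable A /\
  exists T : nat -> point -> R, [/\ forall n, trig_poly (fun x => (T n x)%:C),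
    forall n x, `|T n x| <= 1 &
    {ae mu, forall x : point, T ^~ x @ \oo --> (\1_A x : R)}].

Lemma poly_limitI : setI_closed poly_limit.
Proof.
move=> A B [mA [S [tS S1 cS]]] [mB [T [tT T1 cT]]].
split; first exact: measurableI.
exists (fun n x => S n x * T n x); split.
- by move=> n; apply: trig_poly_ext (trig_polyM (tS n) (tT n)) => x;
  rewrite rmorphM.
- by move=> n x; rewrite normrM mulr_ile1.
- apply: filterS2 cS cT => x cS cT; rewrite indicI; exact: cvgM.
Qed.

Lemma indic_sqint (A : set point) : measurable A ->
  (fun x => (\1_A x : R)%:C) \in sqint.
Proof.
move=> mA; apply: (@bounded_square_integrable _ _ _ 1).
- exact: measurable_indic.
- exact: measurable_cst.
- move=> x; rewrite normc2_real indicE; case: (_ \in _);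
  by rewrite ?expr1n ?expr0n.
Qed.

Lemma poly_limit_approx A : poly_limit A ->
  fun_approx (fun x => (\1_A x : R)%:C).
Proof.
move=> [mA [T [tT T1 cT]]].
(* Both functions take values in [[-1, 1]], so the squared error is at most 4. *)
apply: (@fun_approx_cvg T _ (cst 4)) => //.
- by move=> n; exact: trig_poly_approx.
- exact: indic_sqint.
- exact: finite_measure_integrable_cst.
- move=> n x; have := T1 n x; rewrite ler_norml indicE => /andP[h1 h2] /=.
  by case: (_ \in _); rewrite /=; nra.
Qed.

Lemma measurable_coord_lt (j : 'I_d) (b : R) :
  measurable [set x : point | (tnth x j : R) < b].
Proof.
rewrite (_ : mkset _ = (fun x : point => tnth x j) @^-1` `]-oo, b[).
  by rewrite -[_ @^-1` _]setTI; apply: (@measurable_tnth _ _ _ j).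
by apply/seteqP; split => x; rewrite /= in_itv.
Qed.

(** All real [b] are covered because these sets must generate the sigma-algebra of all tuples. For
    [b <= 0] or [b >= 2 pi] the set is almost everywhere empty or full, and constants serve. *)
Lemma poly_limit_ray (j : 'I_d) (b : R) : poly_limit [set x | (tnth x j :
  R) < b].
Proof.
split; first exact: measurable_coord_lt.
have aej := @ae_torus_coord R d j.
have [b0|b0] := leP b 0.
  exists (fun _ _ => 0); split => [n|n x|];
    [exact: trig_poly0|by rewrite normr0|].
  move: aej; apply: filterS => x /andP[x0 x1]; rewrite indicE memNset;
    first exact: cvg_cst.
  by rewrite /=; apply/negP; rewrite -leNgt; apply: le_trans (ltW x0).
have [b1|b1] := leP (2 * pi) b.
  exists (fun _ _ => 1); split => [n|n x|];
    [exact: trig_poly_cst|by rewrite normr1|].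
  move: aej; apply: filterS => x /andP[x0 x1]; rewrite indicE mem_set;
    first exact: cvg_cst.
  exact: lt_le_trans b1.
(* [y x < 1 / 2] iff [cos (b / 2) < cos (x_j - b / 2)] iff [x_j < b]. *)
pose y (x : point) : R := (1 / 2 + cos (b / 2) / 4) + - 4^-1 * cos ((tnth x j :
  R) - b / 2).
have y01 x : 0 <= y x <= 1.
  rewrite /y; have := cos_geN1 (b / 2); have := cos_le1 (b / 2).
  have := cos_geN1 ((tnth x j : R) - b / 2);
    have := cos_le1 ((tnth x j : R) - b / 2).
  move: (cos _) (cos _) => p q *; apply/andP; split; lra.
exists (fun m x => (1 - y x ^+ m) ^+ (2 ^ m)); split.
- move=> n; apply: trig_polyXr.
  apply: (@trig_poly_ext (fun x => (1 + (-1) * (y x ^+ n))%:C)).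
    by move=> x; rewrite mulN1r.
  apply: trig_polyBZ; apply: trig_polyXr; apply: trig_polyBZ;
    exact: trig_poly_cos.
- move=> n x; have ym : 0 <= y x ^+ n <= 1.
    by case/andP: (y01 x) => *; rewrite exprn_ge0 ?exprn_ile1.
  rewrite ger0_norm; last by rewrite exprn_ge0// subr_ge0; case/andP: ym.
  by rewrite exprn_ile1// ?subr_ge0 ?lerBlDr ?lerDl; case/andP: ym.
- apply: filterS2 aej (ae_torus_coord_neq j b) => x x01 xb.
  have [|hlt hne] := cos_shift _ x01 xb; first by rewrite b0.
  have -> : (\1_[set x : point | (tnth x j : R) < b] x : R) =
    (y x < 1 / 2)%R%:R.
    rewrite indicE; congr ((nat_of_bool _)%:R).
    transitivity ((tnth x j : R) < b).
      case: (boolP ((tnth x j : R) < b)) => h; first by rewrite mem_set.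
      by rewrite memNset//=; exact/negP.
    rewrite -hlt /y; move: (cos _) (cos _) => p q.
    by apply/idP/idP => ?; lra.
  apply: step_cvg => //; apply: contra hne => /eqP.
  by rewrite /y; move: (cos _) (cos _) => p q ?; apply/eqP; lra.
Qed.

(** Coordinate preimages of Borel sets generate the sigma-algebra of tuples, and rays generate the
    Borel sets. *)
Lemma measurable_poly_limit : @measurable _ point = <<s poly_limit >>.
Proof.
apply/seteqP; split; last first.
  apply: smallest_sub; last by move=> A [].
  exact: sigma_algebra_measurable.
have coordE (j : 'I_d) (B : set (measurableTypeR R)) : measurable B ->
    <<s poly_limit >> ((fun x : point => tnth x j) @^-1` B).
  have mE : @measurable _ (measurableTypeR R) =
    (@RGenInftyO.G R).-sigma.-measurable.
    exact: RGenInftyO.measurableE.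
  (* The sets [B] whose preimage is generated by [poly_limit] form a sigma-algebra, so it suffices
     that it contains the rays. *)
  suff h : <<s @RGenInftyO.G R >> `<=` [set B | <<s poly_limit >>
      ((fun x : point => tnth x j) @^-1` B)] by rewrite mE; exact: h.
  apply: smallest_sub; last first.
    move=> _ [b ->]; apply: sub_sigma_algebra.
    rewrite (_ : _ @^-1` _ = [set x | (tnth x j : R) < b]);
      first exact: poly_limit_ray.
    by apply/seteqP; split => x; rewrite /= in_itv.
  split.
  - by rewrite /= preimage_set0; exact: sigma_algebra0.
  - move=> A hA; rewrite /= setTD preimage_setC; exact: sigma_algebraC.
  - by move=> F hF; rewrite /= preimage_bigcup; exact: sigma_algebra_bigcup.
apply: smallest_sub; first exact: smallest_sigma_algebra.
apply: (big_ind (fun X => X `<=` <<s poly_limit >>)) => // [A B sA sB|j _].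
  by rewrite subUset; split.
by move=> _ [B mB <-]; rewrite setTI; exact: coordE.
Qed.

Lemma indic_approx (A : set point) : measurable A ->
  fun_approx (fun x => (\1_A x : R)%:C).
Proof.
rewrite measurable_poly_limit => mA.
apply: (@dynkin_induction _ point poly_limit (fun A => fun_approx (fun x =>
  (\1_A x : R)%:C))) => //.
- exact: measurable_poly_limit.
- exact: poly_limitI.
- apply: trig_poly_approx; apply: trig_poly_ext (trig_poly_cst 1) => x.
  by rewrite indicE in_setT.
- exact: poly_limit_approx.
- move=> B mB hB.
  have h1 := trig_poly_approx (trig_poly_cst 1).
  have := fun_approxP (-1) hB h1; congr fun_approx; apply/funext => x.
  rewrite !indicE in_setC; case: (_ \in _); rewrite mulN1r /=.
    by rewrite rmorph1 addNr rmorph0.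
  by rewrite rmorph0 oppr0 add0r.
- move=> F mF tF hF.
  pose S n x : R := \sum_(i < n) \1_(F i) x.
  have hS n : fun_approx (fun x => (S n x)%:C).
    elim: n => [|n IH].
      by have := fun_approx0; congr fun_approx; apply/funext => x;
        rewrite /S big_ord0.
    have := fun_approxP 1 (hF n) IH; congr fun_approx; apply/funext => x.
    by rewrite /S big_ord_recr /= mul1r rmorphD addrC.
  (* By disjointness [x] lies in at most one [F m], so [S n x] jumps at most once, from 0 to 1, as
     soon as [n] exceeds [m]. *)
  have SE x : (exists2 m, F m x & forall n, S n x = (m < n)%N%:R) \/
      (~ (\bigcup_k F k) x /\ forall n, S n x = 0).
    have [[m _ Fm]|Ux] := pselect ((\bigcup_k F k) x); [left|right].
      exists m => // n; rewrite /S.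
      under eq_bigr => i _.
        rewrite (_ : \1_(F i) x = (i == m :> nat)%:R); last first.
          rewrite indicE; congr ((nat_of_bool _)%:R).
          case: eqVneq => [->|im]; first exact: mem_set.
          apply: memNset => Fi; move/eqP: im; apply.
          by apply: (tF i m) => //; exists x.
        over.
      have [mn|nm] := ltnP m n.
        rewrite (bigD1 (Ordinal mn))//= eqxx big1 ?addr0// => i im.
        by rewrite (_ : (i == m :> nat) = false)//;
          apply: contraNF im => /eqP im; apply/eqP/val_inj.
      rewrite big1// => i _; rewrite (_ : (i == m :> nat) = false)//.
      by apply/negbTE; rewrite neq_ltn (leq_trans (ltn_ord i)).
    split=> // n; rewrite /S big1// => i _; rewrite indicE memNset// => Fi.
    by apply: Ux; exists i.
  apply: (@fun_approx_cvg S _ (cst 4)) => //.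
  + by apply: indic_sqint; exact: bigcup_measurable.
  + exact: finite_measure_integrable_cst.
  + apply: aeW => x; have [[m Fm Sx]|[Ux Sx]] := SE x.
      rewrite indicE mem_set/=; last by exists m.
      apply: cvg_near_cst; near=> n; rewrite Sx.
      by rewrite (_ : (m < n)%N)//; near: n; exact: nbhs_infty_gt.
    rewrite indicE memNset//=; apply: cvg_near_cst; near=> n; exact: Sx.
  + move=> n x; rewrite indicE /=.
    have [[m Fm ->]|[Ux ->]] := SE x; last by case: (_ \in _); rewrite /=; lra.
    by case: (_ < _)%N; case: (_ \in _); rewrite /=; lra.
Unshelve. all: by end_near. Qed.

Lemma sqint_real_le (f g : point -> R) :
  (fun x => (f x)%:C) \in sqint -> measurable_fun setT g ->
  (forall x, `|g x| <= `|f x|) -> (fun x => (g x)%:C) \in sqint.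
Proof.
move=> /asboolP[mf _ fi] mg gf; apply/asboolP; split => //.
apply: le_lt_trans fi; apply: ge0_le_integral => //.
- by move=> x _; rewrite lee_fin sqr_ge0.
- by apply/measurable_EFinP; exact: measurable_normc2.
- by apply/measurable_EFinP; exact: measurable_normc2.
- move=> x _; rewrite lee_fin !normc2_real.
  by rewrite -(real_normK (num_real (g x))) -(real_normK (num_real
    (f x))) lerXn2r ?nnegrE.
Qed.

Import HBNNSimple.

Lemma simple_approx (g : {nnsfun point >-> R}) : fun_approx (fun x => (g x)%:C).
Proof.
pose s := finmap.enum_fset (fset_set (range g)); have gE := fimfunEord g.
pose S n x : R := \sum_(i < n) s`_i * \1_(g @^-1` [set s`_i]) x.
(* Induction on the number of level sets taken; [n = size s] gives back [g]. *)
suff hS n : fun_approx (fun x => (S n x)%:C).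
  by have := hS (size s); congr fun_approx; apply/funext => x; rewrite gE.
elim: n => [|n IH].
  by have := fun_approx0; congr fun_approx; apply/funext => x;
    rewrite /S big_ord0.
have mA : measurable (g @^-1` [set s`_n]) by exact: measurable_funPTI.
have := fun_approxP (s`_n)%:C (indic_approx mA) IH.
congr fun_approx; apply/funext => x.
by rewrite /S big_ord_recr /= -rmorphM -rmorphD addrC.
Qed.

Lemma nonneg_approx (f : point -> R) : (fun x => (f x)%:C) \in sqint ->
  (forall x, 0 <= f x) -> fun_approx (fun x => (f x)%:C).
Proof.
move=> hf f0; have mf : measurable_fun setT f by move: hf => /asboolP[].
have mfE : measurable_fun setT (EFin \o f) by exact/measurable_EFinP.
pose g := nnsfun_approx measurableT mfE.
(* Since [0 <= g n x <= f x], the squared error is dominated by the integrable [f ^ 2]. *)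
apply: (@fun_approx_cvg (fun n x => g n x) f (fun x => nc2 (f x)%:C)) => //.
- by move=> n; exact: simple_approx.
- exact: (sqfun_normc2_integrable (SqFun hf)).
- apply: aeW => x.
  have : (EFin \o (fun n => g n x)) @ \oo --> (EFin \o f) x.
    by apply: cvg_nnsfun_approx => // y _; rewrite lee_fin.
  by move=> /fine_cvgP[_].
- move=> n x; rewrite normc2_real.
  have g0 : 0 <= g n x by [].
  have gf : g n x <= f x.
    rewrite -lee_fin /g nnsfun_approxE.
    by apply: (le_approx n (f := EFin \o f)) => // y _; rewrite lee_fin.
  by have := f0 x; nra.
Qed.

Lemma real_approx (f : point -> R) : (fun x => (f x)%:C) \in sqint ->
  fun_approx (fun x => (f x)%:C).
Proof.
move=> hf; have mf : measurable_fun setT f by move: hf => /asboolP[].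
pose p x := Num.max (f x) 0; pose q x := Num.max (- f x) 0.
have mp : measurable_fun setT p by exact: measurable_funrpos.
have mq : measurable_fun setT q by exact: measurable_funrneg.
have hp : fun_approx (fun x => (p x)%:C).
  apply: nonneg_approx => [|x]; last by rewrite le_max lexx orbT.
  by apply: sqint_real_le hf mp _ => x; rewrite /p; case: (leP (f x) 0) => h;
    rewrite ?normr0.
have hq : fun_approx (fun x => (q x)%:C).
  apply: nonneg_approx => [|x]; last by rewrite le_max lexx orbT.
  by apply: sqint_real_le hf mq _ => x; rewrite /q; case: (leP (- f x) 0) => h;
    rewrite ?normrN ?normr0.
have := fun_approxP (-1) hq hp; congr fun_approx; apply/funext => x.
rewrite mulN1r -rmorphN -rmorphD /p /q; congr (_%:C).
by case: (leP (f x) 0); case: (leP (- f x) 0); lra.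
Qed.

Theorem trig_complete (u : L2) : trig_approx u.
Proof.
rewrite -[u]reprK; case: (repr u) => f hf.
suff [h a] : fun_approx f by have -> : SqFun hf = SqFun h by exact: val_inj.
have [mr mi fi] : [/\ measurable_fun [set: point] (fun x => Re (f x) : R),
    measurable_fun [set: point] (fun x => Im (f x) : R) &
    (\int[mu]_x (nc2 (f x))%:E < +oo)%E] by move: (hf) => /asboolP.
have hr : (fun x => (Re (f x))%:C) \in sqint.
  apply/asboolP; split => //; apply: le_lt_trans fi;
    apply: ge0_le_integral => //.
  - by move=> x _; rewrite lee_fin sqr_ge0.
  - by apply/measurable_EFinP; exact: measurable_normc2.
  - by apply/measurable_EFinP; exact: measurable_normc2.
  - by move=> x _; rewrite lee_fin normc2_real normc2E lerDl sqr_ge0.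
have hi : (fun x => (Im (f x))%:C) \in sqint.
  apply/asboolP; split => //; apply: le_lt_trans fi;
    apply: ge0_le_integral => //.
  - by move=> x _; rewrite lee_fin sqr_ge0.
  - by apply/measurable_EFinP; exact: measurable_normc2.
  - by apply/measurable_EFinP; exact: measurable_normc2.
  - by move=> x _; rewrite lee_fin normc2_real normc2E lerDr sqr_ge0.
have := fun_approxP 'i (real_approx hi) (real_approx hr).
congr fun_approx; apply/funext => x; case: (f x) => a b.
by apply/eqP; rewrite eq_complex /= !mul0r !mulr0 mul1r subr0 !add0r addr0
  !eqxx.
Qed.

Corollary parseval_esum (u : L2) : ((L2norm2 u)%:E <=
  \esum_(k in [set: d.-tuple int]) (nc2 (fourier_coef k u))%:E)%E.
Proof. by apply: parseval_le; exact: trig_complete. Qed.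
End Density.

(** * Approximation numbers of the embedding *)

Section Operators.
Context {R : realType} (d : nat) (s : R) (s_ge0 : 0 <= s).
Local Notation L2 := (@Defs.L2 R d).
Local Notation Hmix := (@Defs.Hmix R d s).
Local Notation nc2 z := (Normc.normc z ^+ 2).
Local Notation w := (@mix_weight R d s).

Definition Hmix_proj (t : seq (d.-tuple int)) (f : Hmix) :
  L2 := trig_proj t (val f).

Lemma Hmix_proj_linear t : linear (Hmix_proj t).
Proof.
move=> a u v; rewrite /Hmix_proj linearP.
by rewrite trig_projD trig_projZ.
Qed.

HB.instance Definition _ t := GRing.isLinear.Build R[i] Hmix L2 _
  (Hmix_proj t) (Hmix_proj_linear t).

Lemma mix_weight_ge1 k : 1 <= w k.
Proof.
rewrite /mix_weight; elim/big_ind: _ => // [x y x1 y1|j _].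
  by rewrite -[1]mulr1 ler_pM.
rewrite -[leLHS](powRr0 (1 + `|(tnth k j)%:~R| ^+ 2)) ler_powR// lerDl.
exact: sqr_ge0.
Qed.

Lemma Hmix_norm2_lty (f : Hmix) : (Hmix_norm2 s (val f) < +oo)%E.
Proof. by case: f => f /= /asboolP. Qed.

Lemma Hmix_norm2_ge0 (u : L2) : (0 <= Hmix_norm2 s u)%E.
Proof.
by apply: esum_ge0 => k _; rewrite lee_fin mulr_ge0 ?sqr_ge0// mix_weight_ge0.
Qed.

Lemma Hmix_normE (f : Hmix) : Hmix_norm2 s (val f) = (Hmix_norm f ^+ 2)%:E.
Proof.
rewrite /Hmix_norm sqr_sqrtr; last by apply: fine_ge0; exact: Hmix_norm2_ge0.
by rewrite fineK// ge0_fin_numE ?Hmix_norm2_ge0 ?Hmix_norm2_lty.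
Qed.

Lemma Hmix_norm2_ge_sum (u : L2) (t : seq (d.-tuple int)) : uniq t ->
  ((\sum_(k <- t) nc2 (fourier_coef k u) * w k)%:E <= Hmix_norm2 s u)%E.
Proof.
move=> ut; apply: esum_ge; exists [set` t].
  by split=> //; exact: finite_seq.
by rewrite -fsbig_seq// sumEFin.
Qed.

Lemma trig_sum_Hmix2 (t : seq (d.-tuple int)) c : uniq t ->
  Hmix_norm2 s (trig_sum t c : L2) = (\sum_(k <- t) nc2 (c k) * w k)%:E.
Proof.
move=> ut; rewrite /Hmix_norm2.
have tE k : (nc2 (fourier_coef k (trig_sum t c)) * w k)%:E =
    if k \in [set` t] then (nc2 (c k) * w k)%:E else 0%E.
  rewrite fourier_coef_trig_sum// (_ : (k \in [set` t]) = (k \in t));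
    last first.
    by case: (boolP (k \in t)) => h; [rewrite mem_set|rewrite memNset//=;
      exact/negP].
  by case: ifP => // _; rewrite normc2E /= expr0n addr0 mul0r.
under eq_esum do rewrite tE.
rewrite -(@esum_mkcond _ _ [set` t] (fun k => (nc2 (c k) * w k)%:E)) esum_fset.
- by rewrite -fsbig_seq// sumEFin.
- exact: finite_seq.
- by move=> k _; rewrite lee_fin mulr_ge0 ?sqr_ge0// mix_weight_ge0.
Qed.

Lemma trig_sum_in_Hmix (t : seq (d.-tuple int)) c : uniq t ->
  (trig_sum t c : L2) \in in_Hmix s.
Proof. by move=> ut; apply/asboolP; rewrite trig_sum_Hmix2// ltry. Qed.

Definition Hmix_trig t c (ut : uniq t) : Hmix := MkHmix (trig_sum_in_Hmix c ut).

Lemma Hmix_norm_trig t c (ut : uniq t) :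
  Hmix_norm (Hmix_trig c ut) ^+ 2 = \sum_(k <- t) nc2 (c k) * w k.
Proof. by apply: EFin_inj; rewrite -Hmix_normE trig_sum_Hmix2. Qed.

Lemma L2norm2_Hmix_proj t (f : Hmix) : uniq t ->
  L2norm2 (Hmix_proj t f) <= Hmix_norm f ^+ 2.
Proof.
move=> ut; rewrite L2norm2_trig_sum// -lee_fin -Hmix_normE.
apply: le_trans (Hmix_norm2_ge_sum _ ut); rewrite lee_fin.
by apply: ler_sum => k _; rewrite ler_peMr ?sqr_ge0// mix_weight_ge1.
Qed.

(** The coefficients of the remainder vanish on [t], and off [t] the hypothesis allows inserting the
    factor [B * w k] into each term of Parseval's sum. *)
Lemma L2norm2_sub_Hmix_proj t (f : Hmix) (B : R) : uniq t ->
  (forall k, k \notin t -> 1 <= B * w k) -> 0 <= B ->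
  L2norm2 (val f - Hmix_proj t f) <= B * Hmix_norm f ^+ 2.
Proof.
move=> ut hB B0; rewrite -lee_fin; apply: (le_trans (parseval_esum _)).
rewrite EFinM -Hmix_normE; apply: ge_ereal_sup => _ [A [finA _] <-].
apply: (@le_trans _ _ (B%:E * \sum_(k \in A)
    (nc2 (fourier_coef k (val f)) * w k)%:E)%E); last first.
  by apply: lee_wpmul2l; [rewrite lee_fin|apply: ereal_sup_ubound; exists A].
rewrite ge0_mule_fsumr => [|k]; last first.
  by rewrite lee_fin mulr_ge0 ?sqr_ge0// mix_weight_ge0.
apply: lee_fsum => // k _; rewrite -EFinM lee_fin fourier_coefB
  fourier_coef_trig_sum//.
case: ifPn => kt.
  by rewrite subrr normc2E /= expr0n addr0 !mulr_ge0// ?sqr_ge0//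
    mix_weight_ge0.
by rewrite subr0 mulrCA ler_peMr ?sqr_ge0// hB.
Qed.

Lemma ler_sqr_pos (x y : R) : 0 <= y -> x ^+ 2 <= y ^+ 2 -> x <= y.
Proof.
move=> y0 xy; have [x0|x0] := leP 0 x; last exact: le_trans (ltW x0) y0.
by rewrite -(ler_sqr _ _)// nnegrE.
Qed.

Lemma Hmix_norm_ge0 (f : Hmix) : 0 <= Hmix_norm f.
Proof. exact: sqrtr_ge0. Qed.

Lemma L2norm_ge0 (u : L2) : 0 <= L2norm u.
Proof. exact: sqrtr_ge0. Qed.

(** The projection fixes the single frequencies of [t], so they serve as preimages of a basis of the
    range, and independence is read off from Fourier coefficients. *)
Lemma Hmix_proj_rank t : uniq t -> has_rank (Hmix_proj t : Hmix -> L2) (size t).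
Proof.
move=> ut; pose e (i : 'I_(size t)) : Hmix :=
  Hmix_trig (fun=> 1) (t := [:: tnth (in_tuple t) i]) isT.
have Ae i : Hmix_proj t (e i) = trig_basis (tnth (in_tuple t) i).
  rewrite /Hmix_proj /trig_proj /trig_sum (bigD1_seq (tnth (in_tuple t) i))//=;
    last exact: mem_tnth.
  rewrite /trig_sum !big_seq1 scale1r fourier_coef_basis eqxx scale1r.
  rewrite big1 ?addr0// => k ki.
  by rewrite fourier_coef_basis (negbTE ki) scale0r.
have sumE (c : 'I_(size t) -> R[i]) :
  \sum_(i < size t) c i *: Hmix_proj t (e i) =
   \sum_(i < size t) c i *: trig_basis (tnth (in_tuple t) i).
  by apply: eq_bigr => i _; rewrite Ae.
exists e; split=> [c|f].
  rewrite sumE => c0 i.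
  have := congr1 (fourier_coef (tnth (in_tuple t) i)) c0.
  rewrite fourier_coef0 fourier_coef_sum
    (bigD1 i)//= fourier_coefZ fourier_coef_basis.
  rewrite eqxx mulr1 big1 ?addr0// => j ji;
    rewrite fourier_coefZ fourier_coef_basis.
  rewrite (_ : _ == _ = false) ?mulr0//; apply: contraNF ji => /eqP.
  rewrite !(tnth_nth [tuple 0 | j < d]) /= => /eqP;
    rewrite nth_uniq// => /eqP ij.
  by apply/eqP/val_inj.
exists (fun i => fourier_coef (tnth (in_tuple t) i) (val f)).
by rewrite sumE /Hmix_proj /trig_proj /trig_sum big_tnth.
Qed.

Lemma approximation_number_le n t (B : R) : uniq t -> (size t < n)%N ->
  0 <= B ->
  (forall k, k \notin t -> 1 <= B ^+ 2 * w k) ->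
  (approximation_number (@Hmix_norm R d s) (@L2norm R d) n
    (@Hmix_embedding R d s) <= B%:E)%E.
Proof.
move=> ut tn B0 hB.
pose D (f : Hmix) : L2 := @Hmix_embedding R d s f - Hmix_proj t f.
apply: (@le_trans _ _ (operator_norm (@Hmix_norm R d s) (@L2norm R d) D)).
  apply: ereal_inf_lbound; exists (Hmix_proj t) => //; split.
    exists 1 => f; rewrite mul1r; apply: ler_sqr_pos (Hmix_norm_ge0 _) _.
    exact: L2norm2_Hmix_proj.
  by exists (size t) => //; exact: Hmix_proj_rank.
apply: ge_ereal_sup => _ [f /= f1 <-]; rewrite lee_fin.
apply: ler_sqr_pos => //; apply: le_trans (L2norm2_sub_Hmix_proj f ut hB
  (sqr_ge0 _)) _.
by rewrite ler_piMr ?sqr_ge0// exprn_ile1// Hmix_norm_ge0.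
Qed.

Lemma normcM_real (b : R) (z : R[i]) : nc2 (b%:C * z) = b ^+ 2 * nc2 z.
Proof. by rewrite Normc.normcM exprMn normc2_real. Qed.

Lemma approximation_number_ge n t (B : R) : uniq t -> (n <= size t)%N ->
  0 <= B ->
  (forall k, k \in t -> B ^+ 2 * w k <= 1) ->
  (B%:E <= approximation_number (@Hmix_norm R d s) (@L2norm R d) n
    (@Hmix_embedding R d s))%E.
Proof.
move=> ut nt B0 hB; apply: le_ereal_inf_tmp => _ [A [_ [r rn [e [_ span]]]] <-].
set m := size t in nt.
pose b i := tnth (in_tuple t) i.
pose f (i : 'I_m) : Hmix := Hmix_trig (fun=> 1) (t := [:: b i]) isT.
have vf i : val (f i) = trig_basis
  (b i) by rewrite /= /trig_sum big_seq1 scale1r.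
have /choice[c cE] i := span (f i).
(* Row [i] holds the coordinates of [A (f i)] in the [r] spanning vectors. As [r < n <= m], rows
   outnumber columns and some nonzero row vector is killed by [M]. *)
pose M : 'M[R[i]]_(m, r) := \matrix_(i, j) c i j.
have /rowV0Pn[x /sub_kermxP xM x0] : kermx M != 0.
  rewrite kermx_eq0; apply/negP => /eqP rM.
  by have := rank_leq_col M; rewrite rM leqNgt (leq_trans rn nt).
pose F : Hmix := \sum_i x 0 i *: f i.
have AF : A F = 0.
  rewrite /F linear_sum; under eq_bigr do rewrite linearZ_LR cE scaler_sumr.
  rewrite exchange_big big1// => j _.
  under eq_bigr do rewrite scalerA.
  rewrite -scaler_suml.
  have := congr1 (fun N : 'rV__ => N 0 j) xM; rewrite !mxE => M0.
  rewrite (_ : \sum_(_ < _) _ = 0) ?scale0r// -[RHS]M0.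
  by apply: eq_bigr => i _; rewrite mxE.
have vF : val F = \sum_i x 0 i *: trig_basis (b i).
  rewrite /F linear_sum; apply: eq_bigr => i _; by rewrite linearZ_LR;
    congr (_ *: _); exact: vf.
have cF i : fourier_coef (b i) (val F) = x 0 i.
  rewrite vF fourier_coef_sum (bigD1 i)//= fourier_coefZ fourier_coef_basis.
  rewrite eqxx mulr1 big1 ?addr0// => j ji;
    rewrite fourier_coefZ fourier_coef_basis.
  rewrite (_ : _ == _ = false) ?mulr0//; apply: contraNF ji => /eqP.
  rewrite /b !(tnth_nth [tuple 0 | j < d]) /= => /eqP;
    rewrite nth_uniq// => /eqP ij.
  by apply/eqP/val_inj.
pose cf k := fourier_coef k (val F).
have FE : val F = trig_sum t cf.
  rewrite [LHS]vF /trig_sum [RHS]big_tnth; apply: eq_bigr => i _.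
  by rewrite /cf cF.
set S := \sum_(k <- t) nc2 (cf k).
set H := \sum_(k <- t) nc2 (cf k) * w k.
have S0 : 0 < S.
  have [i xi] : exists i, x 0 i != 0.
    apply/existsP; apply: contraNT x0; rewrite negb_exists => /forallP x0.
    by apply/eqP/rowP => i; rewrite mxE; apply/eqP; have := x0 i; rewrite negbK.
  rewrite /S (bigD1_seq (b i)) ?mem_tnth// /cf cF ltr_pwDl//.
    rewrite exprn_gt0// lt_neqAle eq_sym; apply/andP; split; last first.
      by case: (x 0 i) => p q; exact: sqrtr_ge0.
    by apply: contra xi => /eqP /Normc.eq0_normc ->.
  by apply: sumr_ge0 => k _; exact: sqr_ge0.
(* The weights are at least 1, so [H] inherits positivity from [S] and can be divided by. *)
have SH : S <= H.
  by apply: ler_sum => k _; rewrite ler_peMr ?sqr_ge0// mix_weight_ge1.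
have BH : B ^+ 2 * H <= S.
  rewrite /H mulr_sumr big_seq [leRHS]big_seq; apply: ler_sum => k kt.
  by rewrite mulrCA ler_piMr ?sqr_ge0// hB.
have H0 : 0 < H by exact: lt_le_trans SH.
pose a : R := (Num.sqrt H)^-1.
have a2 : a ^+ 2 = H^-1 by rewrite exprVn sqr_sqrtr// ltW.
(* [g] is [F] divided by [sqrt H], written as a trigonometric sum so that both of its norms are
   explicit. *)
pose g := Hmix_trig (fun k => a%:C * cf k) ut.
have gE : g = a%:C *: F.
  apply: val_inj; rewrite linearZ_LR /= FE /trig_sum scaler_sumr.
  by apply: eq_bigr => k _; rewrite scalerA.
have Ng : Hmix_norm g <= 1.
  apply: ler_sqr_pos => //; rewrite Hmix_norm_trig expr1n.
  under eq_bigr do rewrite normcM_real -mulrA.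
  by rewrite -mulr_sumr -/H a2 mulVf// gt_eqF.
apply: (@le_trans _ _ (L2norm (@Hmix_embedding R d s g - A g))%:E); last first.
  by apply: ereal_sup_ubound; exists g.
have Ag : A g = 0 by rewrite gE linearZ_LR AF scaler0.
rewrite Ag subr0 lee_fin.
apply: ler_sqr_pos (L2norm_ge0 _) _; rewrite [leRHS](L2norm2_trig_sum _ ut).
under eq_bigr do rewrite normcM_real.
by rewrite -mulr_sumr -/S a2 mulrC ler_pdivlMr.
Qed.
End Operators.

(** * Lattice points in hyperbolic crosses *)

Section Counting.
Context {R : realType}.
Implicit Types (a b r c : R).

(** A mean value estimate: the difference is [a - b] times a sum of [m + 1] monomials, each between
    [b ^ m] and [a ^ m]. *)
Lemma exprS_diff_bounds a b m : 0 <= b <= a ->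
  m.+1%:R * (a - b) * b ^+ m <= a ^+ m.+1 - b ^+ m.+1 <=
    m.+1%:R * (a - b) * a ^+ m.
Proof.
move=> /andP[b0 ab]; have a0 : 0 <= a by exact: le_trans ab.
elim: m => [|m IH]; first by rewrite !mul1r !mulr1 !expr1 lexx.
have bm : b ^+ m.+1 <= a ^+ m.+1 by rewrite lerXn2r.
have bm0 : 0 <= b ^+ m by exact: exprn_ge0.
have am0 : 0 <= a ^+ m by exact: exprn_ge0.
case/andP: IH => IH1 IH2.
have E : a ^+ m.+2 - b ^+ m.+2 = a * (a ^+ m.+1 - b ^+ m.+1) +
  (a - b) * b ^+ m.+1.
  by rewrite mulrBr mulrBl -!exprS addrA subrK.
rewrite E -[m.+2%:R]natr1; move: (m.+1%:R : R) (ler0n R m.+1) IH1 IH2 =>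
  M M0 IH1 IH2.
apply/andP; split.
  apply: (@le_trans _ _ (b * (M * (a - b) * b ^+ m) + (a - b) * b ^+ m.+1)).
    by rewrite le_eqVlt; apply/orP; left; apply/eqP; rewrite !exprS; ring.
  rewrite lerD2r; apply: (@le_trans _ _ (a * (M * (a - b) * b ^+ m))).
    by rewrite ler_wpM2r// !mulr_ge0// subr_ge0.
  by rewrite ler_wpM2l.
apply: (@le_trans _ _ (a * (M * (a - b) * a ^+ m) + (a - b) * a ^+ m.+1)).
  by rewrite lerD// ler_wpM2l// subr_ge0.
by rewrite le_eqVlt; apply/orP; left; apply/eqP; rewrite !exprS; ring.
Qed.

(** Both sides are [ln (1 + x) <= x], at [x = - 1 / (j + 1)] and at [x = 1 / j]. *)
Lemma ln_succ_bounds j : (0 < j)%N ->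
  j.+1%:R^-1 <= ln (j.+1%:R : R) - ln j%:R <= j%:R^-1.
Proof.
move=> j0; have j0' : 0 < j%:R :> R by rewrite ltr0n.
have k0 : 0 < j.+1%:R :> R by rewrite ltr0n.
rewrite -ln_div ?posrE//; apply/andP; split.
  rewrite -lerN2 -lnV ?posrE ?divr_gt0// invf_div.
  rewrite (_ : j%:R / _ = 1 + - j.+1%:R^-1); last first.
    by rewrite -natr1; field; rewrite natr1 gt_eqF.
  apply: le_ln1Dx; rewrite ltrN2 invf_lt1// ltr1n.
  by rewrite ltnS.
rewrite (_ : _ / j%:R = 1 + j%:R^-1); last by rewrite -natr1; field;
  rewrite gt_eqF.
by apply: le_ln1Dx; rewrite (@lt_trans _ _ 0)// ?invr_gt0// ltrN10.
Qed.

(* The primitive of [(ln (r / x) + c) ^ m / x], differenced over unit steps,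
   dominates the terms of the sum. *)
Lemma sum_ln_upper r c m : 1 <= r -> 0 <= c ->
  \sum_(1 <= j < Num.trunc r) (ln (r / j.+1%:R) + c) ^+ m / j.+1%:R <=
  (ln r + c) ^+ m.+1 / m.+1%:R.
Proof.
move=> r1 c0; have r0 : 0 < r by exact: lt_le_trans r1.
pose g j := ln (r / j%:R) + c.
have g0 j : (0 < j <= Num.trunc r)%N -> 0 <= g j.
  move=> /andP[j0 jr]; rewrite addr_ge0// ln_ge0// ler_pdivlMr ?ltr0n// mul1r.
  by rewrite -truncn_ge_nat ?ltW.
have gS j : (0 < j)%N -> j.+1%:R^-1 <= g j - g j.+1.
  move=> j0; case/andP: (ln_succ_bounds j0) => h _; apply: le_trans h _.
  by rewrite /g !ln_div ?posrE ?ltr0n//; lra.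
have -> : ln r + c = g 1%N by rewrite /g divr1.
have N0 : (0 < Num.trunc r)%N by rewrite truncn_gt0.
apply: (@le_trans _ _ (\sum_(1 <= j < Num.trunc r)
    ((- (g j.+1 ^+ m.+1 / m.+1%:R)) - (- (g j ^+ m.+1 / m.+1%:R))))).
  rewrite big_nat_cond [leRHS]big_nat_cond; apply: ler_sum => j.
  rewrite andbT => /andP[j0 jN].
  have g1 : 0 <= g j.+1 by rewrite g0.
  have gl : g j.+1 <= g j by rewrite -subr_ge0; apply: le_trans (gS _ j0);
    rewrite invr_ge0.
  have /andP[h _] := @exprS_diff_bounds (g j) (g j.+1) m (introT andP
    (conj g1 gl)).
  rewrite opprK [leRHS]addrC -mulrBl ler_pdivlMr ?ltr0n//; apply: le_trans h.
  rewrite mulrC -mulrA ler_wpM2l// mulrC; apply: ler_wpM2r;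
    first exact: exprn_ge0.
  exact: gS.
rewrite telescope_sumr// opprK addrC lerBlDr lerDl.
by rewrite divr_ge0// exprn_ge0// g0// N0 leqnn.
Qed.

Lemma sum_ln_lower r m : 1 <= r ->
  ln r ^+ m.+1 / m.+1%:R <=
  \sum_(0 <= j < Num.trunc r) ln (r / j.+1%:R) ^+ m / j.+1%:R.
Proof.
move=> r1; have r0 : 0 < r by exact: lt_le_trans r1.
(* Cutting off at 0 makes the telescoping sum end in exactly 0, because [r] is less than its
   truncation plus 1. *)
pose g j := Num.max (ln (r / j%:R)) 0.
have g0 j : 0 <= g j by rewrite le_max lexx orbT.
have gE j : (j < Num.trunc r)%N -> g j.+1 = ln (r / j.+1%:R).
  move=> jr; rewrite /g max_l// ln_ge0// ler_pdivlMr ?ltr0n// mul1r.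
  by rewrite -truncn_ge_nat ?ltW.
have gS j : (0 < j)%N -> 0 <= g j - g j.+1 <= j%:R^-1.
  move=> j0; case/andP: (ln_succ_bounds j0) => h1 h2.
  have h0 : 0 <= j.+1%:R^-1 :> R by rewrite invr_ge0.
  have h3 : 0 <= j%:R^-1 :> R by rewrite invr_ge0.
  rewrite /g !ln_div ?posrE ?ltr0n//.
  move: (ln r) (ln j%:R) (ln j.+1%:R) (j%:R^-1) (j.+1%:R^-1) h1 h2 h0 h3 =>
    x y z u v *.
  by case: (leP (x - y) 0); case: (leP (x - z) 0) => *; apply/andP; split; lra.
rewrite (_ : ln r = g 1%N); last by rewrite /g divr1 max_l// ln_ge0.
have gN : g (Num.trunc r).+1 = 0.
  rewrite /g max_r// ln_le0// ler_pdivrMr ?ltr0n// mul1r ltW//.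
  exact: truncnS_gt.
apply: (@le_trans _ _ (\sum_(0 <= j < Num.trunc r)
    ((- (g j.+2 ^+ m.+1 / m.+1%:R)) - (- (g j.+1 ^+ m.+1 / m.+1%:R))))).
  by rewrite telescope_sumr// gN expr0n mul0r oppr0 sub0r opprK.
rewrite big_nat_cond [leRHS]big_nat_cond; apply: ler_sum => j.
rewrite andbT => /andP[_ jN]; rewrite -gE//.
have /andP[gl gu] := gS j.+1 isT; rewrite subr_ge0 in gl.
have /andP[_ h] := @exprS_diff_bounds (g j.+1) (g j.+2) m (introT andP (conj
  (g0 _) gl)).
rewrite opprK [leLHS]addrC -mulrBl ler_pdivrMr ?ltr0n//; apply: le_trans h _.
rewrite -mulrA mulrC ler_wpM2r// mulrC ler_wpM2l// exprn_ge0//.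
Qed.

(** The integers of absolute value below [N]. As [Negz j] is [- (j + 1)], the negative range is one
    shorter. *)
Definition int_ball N : seq int :=
  [seq Posz j | j <- iota 0 N] ++ [seq Negz j | j <- iota 0 N.-1].

Lemma mem_int_ball N (k : int) : (k \in int_ball N) = (absz k < N)%N.
Proof.
rewrite mem_cat; apply/orP/idP => [[/mapP[j]|/mapP[j]]|].
- by rewrite mem_iota /= add0n => jN ->.
- by rewrite mem_iota /= add0n => jN -> /=; rewrite -ltn_predRL.
- case: k => j jN; [left|right]; apply/mapP; exists j => //.
    by rewrite mem_iota.
  by rewrite mem_iota /= ltn_predRL.
Qed.

Lemma uniq_int_ball N : uniq (int_ball N).
Proof.
rewrite cat_uniq !map_inj_uniq ?iota_uniq ?andbT /=; last 2 first.
- by move=> i j [].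
- by move=> i j [].
by apply/hasPn => _ /mapP[j _ ->]; apply/mapP => -[].
Qed.

Definition intabs (k : int) : R := `|k%:~R|.

Lemma intabsE k : intabs k = (absz k)%:R.
Proof. by rewrite natr_absz intr_norm. Qed.

Lemma mem_int_ball_trunc (r : R) k :
  (k \in int_ball (Num.trunc r)) = (1 + intabs k <= r).
Proof. by rewrite mem_int_ball truncn_gt_nat intabsE addrC natr1. Qed.

(** Zero occurs once and every other absolute value twice, hence the different lower limits. *)
Lemma sum_int_ball N (F : R -> R) :
  \sum_(k <- int_ball N) F (1 + intabs k) =
  \sum_(0 <= j < N) F j.+1%:R + \sum_(1 <= j < N) F j.+1%:R.
Proof.
rewrite big_cat !big_map; congr (_ + _).
  by rewrite /index_iota subn0; apply: eq_bigr => j _;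
    rewrite intabsE addrC natr1.
rewrite (big_addn 0 N 1) subn1 /index_iota subn0; apply: eq_bigr => j _.
by rewrite intabsE addrC natr1 addn1.
Qed.

Definition hyp_prod d (k : d.-tuple int) :
  R := \prod_(j < d) (1 + intabs (tnth k j)).

Lemma hyp_prod_cons d k0 (k : d.-tuple int) :
  hyp_prod [tuple of k0 :: k] = (1 + intabs k0) * hyp_prod k.
Proof.
rewrite /hyp_prod big_ord_recl tnth0; congr (_ * _).
by apply: eq_bigr => j _; rewrite tnthS.
Qed.

Lemma intabs_ge0 k : 0 <= intabs k. Proof. exact: normr_ge0. Qed.

Lemma hyp_prod_ge1 d (k : d.-tuple int) : 1 <= hyp_prod k.
Proof.
rewrite /hyp_prod; elim/big_ind: _ => // [x y x1 y1|j _].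
  by rewrite -[1]mulr1 ler_pM.
by rewrite lerDl intabs_ge0.
Qed.

(* The shift by [d] absorbs the multi-indices with vanishing entries. *)
Definition cover_bound d (r : R) : R :=
  2 ^+ d.+1 * r * (ln r + d%:R) ^+ d / d`!%:R.

Lemma cover_boundS d (r : R) : 1 <= r ->
  \sum_(k <- int_ball (Num.trunc r)) cover_bound d (r / (1 + intabs k)) <=
  cover_bound d.+1 r.
Proof.
move=> r1; have r0 : 0 < r by exact: lt_le_trans r1.
have N0 : (0 < Num.trunc r)%N by rewrite truncn_gt0.
rewrite (sum_int_ball _ (fun x => cover_bound d (r / x))) (big_ltn N0) divr1.
set S := \sum_(1 <= j < _) _.
have := sum_ln_upper d r1 (ler0n R d).
set a := ln r + d%:R; set T := \sum_(1 <= j < _) _ => hT.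
have a0 : 0 <= a by rewrite addr_ge0// ln_ge0.
pose K := 2 ^+ d.+1 * r / d`!%:R.
have K0 : 0 <= K by rewrite divr_ge0// mulr_ge0// ?exprn_ge0// ltW.
have -> : S = K * T.
  rewrite /S /T mulr_sumr; apply: eq_bigr => j _; rewrite /cover_bound /K.
  set p := (_ + _) ^+ d; set q := (d`!%:R)^-1; set u := 2 ^+ _;
    set v := _.+1%:R^-1; ring.
have -> : cover_bound d r = K * a ^+ d.
  rewrite /cover_bound /K -/a.
  set p := a ^+ d; set q := (d`!%:R)^-1; set u := 2 ^+ _; ring.
have -> : cover_bound d.+1 r = K * (2 * (a + 1) ^+ d.+1 / d.+1%:R).
  have aS : ln r + d.+1%:R = a + 1 by rewrite -natr1 addrA.
  rewrite /cover_bound /K (exprS 2 d.+1) aS factS natrM invfM.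
  set p := (a + 1) ^+ d.+1; set q := (d`!%:R)^-1; set u := 2 ^+ _;
    set v := d.+1%:R^-1; ring.
rewrite -addrA -!mulrDr; apply: ler_wpM2l => //.
(* The increment of [x ^ (d + 1)] from [a] to [a + 1] is at least [(d + 1) a ^ d], which pays for
   the slice [k0 = 0]; the slices [k0 != 0] are paid by [a ^ (d + 1)] through [hT]. *)
have /andP[h _] : d.+1%:R * (a + 1 - a) * a ^+ d <=
  (a + 1) ^+ d.+1 - a ^+ d.+1 <=
    d.+1%:R * (a + 1 - a) * (a + 1) ^+ d by apply: exprS_diff_bounds;
      rewrite a0 lerDl ler01.
have d0 : 0 < d.+1%:R :> R by rewrite ltr0n.
have ad : 0 <= a ^+ d by exact: exprn_ge0.
move: hT; rewrite !ler_pdivlMr// (addrC a) addrK mulr1 in h *.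
move: (a ^+ d) (a ^+ d.+1) ((1 + a) ^+ _) (d.+1%:R : R) d0 ad h =>
  p q u D D0 p0 h1 h2.
nra.
Qed.

(** For [r < 1] the cross is empty, while [cover_bound] may be negative; emptiness of [t] is
    therefore recorded apart from the bound. *)
Lemma hyperbolic_cover d (r : R) : exists t : seq (d.+1.-tuple int),
  [/\ forall k, hyp_prod k <= r -> k \in t, r < 1 -> t = [::] &
      1 <= r -> (size t)%:R <= cover_bound d r].
Proof.
elim: d r => [|d IHd] r.
  exists [seq [tuple k] | k <- int_ball (Num.trunc r)]; split.
  - move=> k; case/tupleP: k => k0 k; rewrite tuple0 hyp_prod_cons => kr.
    apply/mapP; exists k0; last exact: val_inj.
    by rewrite mem_int_ball_trunc; move: kr; rewrite /hyp_prod big_ord0 mulr1.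
  - by move=> r1; rewrite (_ : Num.trunc r = 0%N)//; apply/truncn0Pn;
    rewrite -ltNge.
  - move=> r1; rewrite size_map size_cat !size_map !size_iota /cover_bound.
    rewrite expr0 fact0 divr1 mulr1 expr1 natrD mulr_natl mulr2n.
    have h : (Num.trunc r)%:R <= r by rewrite truncn_le (le_trans _ r1).
    by rewrite lerD// (le_trans _ h)// ler_nat leq_pred.
have /choice[T hT] := IHd.
exists [seq [tuple of k0 :: (k : d.+1.-tuple int)] | k0 <- int_ball
  (Num.trunc r),
  k <- T (r / (1 + intabs k0))]; split.
- move=> k; case/tupleP: k => k0 k; rewrite hyp_prod_cons => kr.
  have k0p : 0 < 1 + intabs k0 by rewrite ltr_pwDl// intabs_ge0.
  apply/allpairsPdep; exists k0, k; split => //.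
    rewrite mem_int_ball_trunc; apply: le_trans kr.
    by rewrite ler_peMr ?(ltW k0p)// hyp_prod_ge1.
  by have [h _ _] := hT (r / (1 + intabs k0)); apply: h;
    rewrite ler_pdivlMr// mulrC.
- move=> r1; rewrite (_ : Num.trunc r = 0%N)//; apply/truncn0Pn;
  by rewrite -ltNge.
- move=> r1; apply: le_trans (cover_boundS d r1).
  rewrite size_allpairs_dep sumnE natr_sum big_map big_seq [leRHS]big_seq.
  apply: ler_sum => k; rewrite mem_int_ball_trunc => kr.
  have [_ _] := hT (r / (1 + intabs k)); apply.
  by rewrite ler_pdivlMr ?mul1r// ltr_pwDl// intabs_ge0.
Qed.

Definition mix_prod d (k : d.-tuple int) :
  R := \prod_(j < d) (1 + intabs (tnth k j) ^+ 2).

Lemma mix_prod_cons d k0 (k : d.-tuple int) :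
  mix_prod [tuple of k0 :: k] = (1 + intabs k0 ^+ 2) * mix_prod k.
Proof.
rewrite /mix_prod big_ord_recl tnth0; congr (_ * _).
by apply: eq_bigr => j _; rewrite tnthS.
Qed.

Lemma mix_prod_ge1 d (k : d.-tuple int) : 1 <= mix_prod k.
Proof.
rewrite /mix_prod; elim/big_ind: _ => // [x y x1 y1|j _].
  by rewrite -[1]mulr1 ler_pM.
by rewrite lerDl sqr_ge0.
Qed.

Lemma hyp_prod_le d (k : d.-tuple int) : hyp_prod k ^+ 2 <= 2 ^+ d * mix_prod k.
Proof.
rewrite /hyp_prod /mix_prod -prodrXl -[X in _ ^+ X](card_ord d) -prodr_const
  -big_split.
apply: ler_prod => j _; rewrite sqr_ge0 /=.
by have := intabs_ge0 (tnth k j); move: (intabs _) => x x0;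
  have := sqr_ge0 (x - 1); nra.
Qed.

(* The factor [1 / sqrt 2] is forced by [d = 0], where [r] close to [sqrt 2]
   leaves only the frequency [0]. *)
Definition fill_bound d (r : R) : R := r * ln r ^+ d / d`!%:R / Num.sqrt 2.

Lemma fill_boundS d (r : R) : 1 <= r ->
  fill_bound d.+1 r <= \sum_(0 <= j < Num.trunc r) fill_bound d (r / j.+1%:R).
Proof.
move=> r1; have r0 : 0 < r by exact: lt_le_trans r1.
have h := sum_ln_lower d r1.
pose K := r / d`!%:R / Num.sqrt 2.
have K0 : 0 <= K by rewrite !divr_ge0// ?ltW ?sqrtr_ge0.
have -> : fill_bound d.+1 r = K * (ln r ^+ d.+1 / d.+1%:R).
  rewrite /fill_bound /K factS natrM invfM.
  set p := _ ^+ _; set q := (d`!%:R)^-1; set u := d.+1%:R^-1;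
    set v := (Num.sqrt _)^-1; ring.
apply: (le_trans (ler_wpM2l K0 h)); rewrite mulr_sumr; apply: ler_sum => j _.
rewrite /fill_bound /K le_eqVlt; apply/orP; left; apply/eqP.
set p := _ ^+ _; set q := (d`!%:R)^-1; set u := j.+1%:R^-1;
  set v := (Num.sqrt _)^-1; ring.
Qed.

Lemma fill_bound1 (r : R) : 1 <= r -> exists2 t : seq (1.-tuple int),
  uniq t /\ (forall k, k \in t -> mix_prod k <= r ^+ 2) & fill_bound 0 r <=
    (size t)%:R.
Proof.
move=> r1; have r0 : 0 < r by exact: lt_le_trans r1.
have r21 : 0 <= r ^+ 2 - 1 by rewrite subr_ge0 exprn_ege1.
set K := Num.trunc (Num.sqrt (r ^+ 2 - 1)).
exists [seq [tuple k] | k <- int_ball K.+1].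
  split; first by rewrite map_inj_uniq ?uniq_int_ball// => x y [].
  move=> _ /mapP[k kK ->]; rewrite
    (mix_prod_cons k [tuple]) /mix_prod big_ord0 mulr1.
  move: kK; rewrite mem_int_ball ltnS truncn_ge_nat ?sqrtr_ge0// -intabsE => h.
  rewrite -lerBrDl -[leRHS]sqr_sqrtr//.
  by rewrite lerXn2r ?nnegrE ?sqrtr_ge0 ?intabs_ge0.
rewrite size_map size_cat !size_map !size_iota /fill_bound expr0 fact0 divr1
  mulr1 /=.
rewrite ler_pdivrMr ?sqrtr_gt0//.
have KS : Num.sqrt (r ^+ 2 - 1) < K.+1%:R by exact: truncnS_gt.
rewrite -(ler_sqr _ _) ?nnegrE ?ltW// ?mulr_ge0// ?sqrtr_ge0//.
rewrite exprMn sqr_sqrtr//.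
(* The [2 K + 1] frequencies suffice because [r ^ 2 < (K + 1) ^ 2 + 1 <= 2 (2 K + 1) ^ 2], the last
   step being an equality at [K = 0]. *)
have : r ^+ 2 - 1 < K.+1%:R ^+ 2.
  by rewrite -[ltLHS]sqr_sqrtr// ltrXn2r ?nnegrE ?sqrtr_ge0.
rewrite natrD -natr1; have := ler0n R K; move: (K%:R : R) (r ^+ 2) => x y *;
  nra.
Qed.

Lemma hyperbolic_fill d (r : R) : 1 <= r -> exists2 t : seq (d.+1.-tuple int),
  uniq t /\ (forall k, k \in t -> mix_prod k <= r ^+ 2) & fill_bound d r <=
    (size t)%:R.
Proof.
elim: d r => [|d IHd] r r1; first exact: fill_bound1.
have r0 : 0 < r by exact: lt_le_trans r1.
(* The guard [1 <= x] makes the family total, as [choice] demands; the empty list is a dummy value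
   below 1. *)
have /choice[T hT] : forall x : R, exists t : seq (d.+1.-tuple int), 1 <= x ->
    [/\ uniq t, forall k, k \in t -> mix_prod k <= x ^+ 2 & fill_bound d x <=
      (size t)%:R].
  move=> x; have [x1|x1] := leP 1 x; last by exists [::].
  by have [t [ut ht] st] := IHd _ x1; exists t.
have rj j : (j < Num.trunc r)%N -> 1 <= r / j.+1%:R.
  by move=> jr; rewrite ler_pdivlMr ?ltr0n// mul1r -truncn_ge_nat ?ltW.
(* Only slices with first entry [j >= 0] are kept. Since [1 + j ^ 2 <= (1 + j) ^ 2], radius
   [r / (j + 1)] is safe in the remaining coordinates. *)
exists [seq [tuple of Posz j :: (k :
  d.+1.-tuple int)] | j <- iota 0 (Num.trunc r),
  k <- T (r / j.+1%:R)].
  split.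
    apply: allpairs_uniq_dep; first exact: iota_uniq.
      move=> j; rewrite mem_iota add0n => /andP[_ jr].
      by have [] := hT _ (rj _ jr).
    move=> [i x] [j y] _ _ /= [] ij /val_inj xy.
    by rewrite ij xy.
  move=> _ /allpairsPdep[j [k [jr kT ->]]].
  move: jr; rewrite mem_iota add0n => /andP[_ jr].
  have [_ /(_ _ kT) h _] := hT _ (rj _ jr).
  rewrite mix_prod_cons intabsE /=.
  have j0 : 0 < j.+1%:R :> R by rewrite ltr0n.
  apply: (@le_trans _ _ (j.+1%:R ^+ 2 * (r / j.+1%:R) ^+ 2)); last first.
    by rewrite -exprMn mulrC divfK// gt_eqF.
  have V0 : 0 <= mix_prod k by rewrite (le_trans _ (mix_prod_ge1 _)).
  have x0 : 0 <= 1 + j%:R ^+ 2 :> R by rewrite addr_ge0// sqr_ge0.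
  apply: ler_pM => //.
  by rewrite -natr1; have := ler0n R j; move: (j%:R : R) => x; nra.
apply: le_trans (fill_boundS d r1) _.
rewrite size_allpairs_dep sumnE natr_sum big_map /index_iota subn0.
rewrite big_seq [leRHS]big_seq; apply: ler_sum => j.
rewrite mem_iota add0n => /andP[_ jr].
by have [] := hT _ (rj _ jr).
Qed.
End Counting.

(** * The two bounds *)

Section Constants.
Context {R : realType}.

Lemma ln_le_subr1 (x : R) : 0 < x -> ln x <= x - 1.
Proof. by move=> x0; rewrite -{1}(subrKC 1 x) le_ln1Dx// ltrBrDl subrr. Qed.

(** From [exp (- 1 / m) >= 1 - 1 / m] one gets [e <= (m / (m - 1)) ^ m], and [m = 6] is the first
    value that brings this below 3. *)
Lemma expR1_le3 : expR 1 <= 3 :> R.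
Proof.
have h : expR (6^-1) <= 6 / 5 :> R.
  have := expRxMexpNx_1 (6^-1 : R); have := expR_ge1Dx (- 6^-1 : R).
  have := expR_gt0 (6^-1 : R); move: (expR _) (expR _) => x y; nra.
have -> : expR 1 = expR (6^-1) ^+ 6 :> R.
  by rewrite -expRM_natl mulfV.
apply: (@le_trans _ _ ((6 / 5) ^+ 6)); last by lra.
by rewrite lerXn2r ?nnegrE ?expR_ge0// ler0n.
Qed.

(** [e ^ 9 <= 3 ^ 9 = 19683 <= 20736 = 12 ^ 4]. *)
Lemma ln12_ge : 9 / 4 <= ln 12 :> R.
Proof.
have : ln (expR 1 ^+ 9) <= ln (12 ^+ 4) :> R.
  rewrite ler_ln ?posrE ?exprn_gt0 ?expR_gt0//.
  apply: (@le_trans _ _ (3 ^+ 9)); last by lra.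
  by rewrite lerXn2r ?nnegrE ?expR_ge0 ?expR1_le3.
by rewrite !lnXn ?expR_gt0// expRK; lra.
Qed.

Lemma fact_le_exp m : m`!%:R <= m%:R ^+ m :> R.
Proof.
elim: m => [|m IH]; first by rewrite fact0 expr0.
rewrite factS natrM exprS ler_wpM2l//; apply: le_trans IH _.
by rewrite lerXn2r ?nnegrE// ler_nat.
Qed.

(** Stirling's lower bound [m! >= (m / e) ^ m]; the induction step is
    [m (ln (m + 1) - ln m) <= 1]. *)
Lemma ln_fact_ge m : (0 < m)%N -> m%:R * ln m%:R - m%:R <= ln m`!%:R :> R.
Proof.
case: m => // m _; elim: m => [|m IH];
  first by rewrite (_ : 1`!%:R = 1 :> R) // ln1; lra.
rewrite factS natrM lnM ?posrE ?ltr0n ?fact_gt0//.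
have /andP[_] := @ln_succ_bounds R m.+1 isT.
have m0 : 0 < m.+1%:R :> R by rewrite ltr0n.
rewrite -[X in _ <= X]mul1r ler_pdivlMr// -[m.+2%:R]natr1.
move: IH.
move: (m.+1%:R : R) => u; move: (ln m.+1`!%:R : R) (ln (u + 1)) (ln u) =>
  x y z; lra.
Qed.
End Constants.

Section MainBounds.
Context {R : realType}.

Lemma mix_weightE (s : R) d (k : d.-tuple int) : mix_weight s k =
  mix_prod k `^ s.
Proof.
suff [] : mix_weight s k = mix_prod k `^ s /\ 0 <= mix_prod k :> R by [].
rewrite /mix_weight /mix_prod.
(* Nonnegativity is carried along because [powRM] requires it of the factors. *)
apply: (big_ind2 (fun x y => x = y `^ s /\ 0 <= y)).
- by rewrite powR1.
- by move=> x1 x2 y1 y2 [-> x0] [-> y0]; rewrite powRM// mulr_ge0.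
- by move=> j _; split=> //; rewrite addr_ge0// sqr_ge0.
Qed.

Lemma powR_merge (K L N s : R) m : 0 <= K -> 0 <= L -> 0 < N ->
  K `^ s * L `^ (m%:R * s) / N `^ s = (K * L ^+ m / N) `^ s.
Proof.
move=> K0 L0 N0; rewrite powRrM powR_mulrn// -powRM ?exprn_ge0//.
rewrite -powRN -[- s]mulN1r powRrM powR_inv1 ?(ltW N0)// -powRM ?invr_ge0 ?(ltW
  N0)//.
by rewrite mulr_ge0 ?exprn_ge0.
Qed.

Lemma sqr_powRM (q V s : R) : 0 <= q -> 0 <= V ->
  (q `^ s) ^+ 2 * V `^ s = (q ^+ 2 * V) `^ s.
Proof. by move=> q0 V0; rewrite !expr2 -!powRM// mulr_ge0. Qed.

Lemma approximation_upper (s : R) (d n : nat) : 0 < s -> (27 ^ d.+1 <= n)%N ->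
  (approximation_number (@Hmix_norm R d.+1 s) (@L2norm R d.+1) n
    (@Hmix_embedding R d.+1 s) <=
   (((3 * Num.sqrt 2) ^+ d.+1 / d`!%:R * ln n%:R ^+ d / n%:R) `^ s)%:E)%E.
Proof.
move=> s0 n27.
have n0 : 0 < n%:R :> R by rewrite ltr0n (leq_trans _ n27)// expn_gt0.
set L := ln n%:R.
(* [e <= 3] gives [e ^ (3 (d + 1)) <= 27 ^ (d + 1) <= n]. *)
have L3 : 3 * d.+1%:R <= L.
  have : ln (expR 1 ^+ 3 ^+ d.+1) <= L.
    rewrite ler_ln ?posrE ?exprn_gt0 ?expR_gt0//.
    apply: (@le_trans _ _ ((3 ^+ 3) ^+ d.+1)).
      rewrite lerXn2r ?nnegrE ?exprn_ge0 ?expR_ge0//.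
      by rewrite lerXn2r ?nnegrE ?expR_ge0 ?expR1_le3.
    by rewrite -!natrX ler_nat.
  rewrite !lnXn ?exprn_gt0 ?expR_gt0// expRK -mulr_natl; lra.
have L0 : 0 < L by apply: lt_le_trans L3; rewrite mulr_gt0.
set q := _ / _ * _ / _.
have f0 : 0 < d`!%:R :> R by rewrite ltr0n fact_gt0.
have q0 : 0 < q.
  by rewrite /q !(divr_gt0, mulr_gt0, exprn_gt0)// sqrtr_gt0.
(* Solves [q * r = sqrt 2 ^ (d + 1)], so that [hyp_prod_le] yields [q ^ 2 * mix_prod k >= 1] outside
   the cross of radius [r]. *)
pose r := n%:R * d`!%:R / (3 ^+ d.+1 * L ^+ d).
have r0 : 0 < r by rewrite divr_gt0 ?mulr_gt0 ?exprn_gt0.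
have qr : q ^+ 2 * r ^+ 2 = 2 ^+ d.+1.
  rewrite -exprMn (_ : q * r = Num.sqrt 2 ^+ d.+1).
    by rewrite -exprM mulnC exprM sqr_sqrtr.
  rewrite /q /r exprMn; field.
  by rewrite !gt_eqF ?exprn_gt0.
have [t [tP t1 tS]] := hyperbolic_cover d r.
apply: (@approximation_number_le R d.+1 s (ltW s0) n (undup t)).
- exact: undup_uniq.
- apply: leq_ltn_trans (size_undup _) _; rewrite -(ltr_nat R).
  have [r1|/t1 ->//] := leP 1 r.
  apply: le_lt_trans (tS r1) _.
  have lr : 0 <= ln r by exact: ln_ge0.
  (* Amounts to [r e ^ d <= n], that is [d! e ^ d <= 3 ^ (d + 1) L ^ d], which holds by [e <= 3] and
     [d! <= d ^ d <= L ^ d]. *)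
  have lrL : ln r + d%:R <= L.
    rewrite -[d%:R]expRK -lnM ?posrE ?expR_gt0// ler_ln ?posrE ?(mulr_gt0 r0)
      ?expR_gt0//.
    rewrite /r mulrAC ler_pdivrMr; last by rewrite mulr_gt0 ?exprn_gt0.
    rewrite -mulrA ler_wpM2l ?(ltW n0)//.
    rewrite mulrC; apply: ler_pM => //; rewrite ?expR_ge0//.
      rewrite -[d%:R]mulr1 expRM_natl; apply: (@le_trans _ _ (3 ^+ d)).
        by rewrite lerXn2r ?nnegrE ?expR_ge0 ?expR1_le3.
      by rewrite exprS ler_peMl// ?exprn_ge0//; lra.
    apply: (le_trans (fact_le_exp d)); rewrite lerXn2r ?nnegrE ?(ltW L0)//.
    by apply: le_trans L3; rewrite -natr1; have := ler0n R d; lra.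
  apply: (@le_lt_trans _ _ (2 ^+ d.+1 * r * L ^+ d / d`!%:R)).
    have K0 : 0 <= 2 ^+ d.+1 * r by rewrite (mulr_ge0 _ (ltW r0))// exprn_ge0.
    rewrite /cover_bound ler_wpM2r ?invr_ge0// (ler_wpM2l K0)//.
    by rewrite lerXn2r ?nnegrE ?(ltW L0)// addr_ge0.
  (* The 3 of the statement against the 2 of [cover_bound] leaves a factor below 1, which gives the
     strict inequality [size t < n]. *)
  rewrite (_ : _ / _ = n%:R * (2 / 3) ^+ d.+1); last first.
    rewrite /r expr_div_n; field.
    by rewrite !gt_eqF ?exprn_gt0.
  by rewrite gtr_pMr// exprn_ilt1//; lra.
- exact: powR_ge0.
- move=> k; rewrite mem_undup => kt.
  have kr : r < hyp_prod k by rewrite ltNge; apply: contra kt; exact: tP.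
  have V1 := @mix_prod_ge1 R _ k.
  rewrite mix_weightE sqr_powRM ?(ltW q0)//; last exact: le_trans V1.
  have e1 : 1 `^ s = 1 :> R by rewrite powR1.
  rewrite -[leLHS]e1; apply: ge0_ler_powR; rewrite ?nnegrE ?(ltW s0)//.
    by rewrite mulr_ge0 ?sqr_ge0// (le_trans _ V1).
  rewrite -(@ler_pM2l _ (2 ^+ d.+1)) ?exprn_gt0// mulr1.
  rewrite mulrCA -[leLHS]qr ler_wpM2l ?sqr_ge0//.
  apply: le_trans (hyp_prod_le k).
  by rewrite lerXn2r ?nnegrE ?(ltW r0)// ltW// (lt_trans r0).
Qed.

(** The estimate [r / sqrt 2] of [fill_bound1] is too weak at the radius of [lower_fill] in
    dimension one. Here the leading coefficient 2 is kept, at the price of an additive loss. *)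
Lemma interval_fill (r : R) : 1 <= r -> exists2 t : seq (1.-tuple int),
  uniq t /\ (forall k, k \in t -> mix_prod k <= r ^+ 2) & 2 * r - 3 <=
    (size t)%:R.
Proof.
move=> r1; have r0 : 0 <= r by exact: le_trans r1.
exists [seq [tuple k] | k <- int_ball (Num.trunc r)].
  split; first by rewrite map_inj_uniq ?uniq_int_ball// => x y [].
  move=> _ /mapP[k kK ->]; rewrite
    (mix_prod_cons k [tuple]) /mix_prod big_ord0 mulr1.
  by move: kK; rewrite (mem_int_ball_trunc r); have := intabs_ge0 (R := R) k;
    nra.
rewrite size_map size_cat !size_map !size_iota natrD -subn1 natrB ?truncn_gt0//.
by have := truncnS_gt r; rewrite -natr1; lra.
Qed.

(* With [x = L / d.+1], [ln x] is bounded by the tangent of [ln] at [a], the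
   infimum of the admissible [x]. *)
Lemma ln_radius_ge (a L : R) d : (0 < d)%N -> 17 / 4 <= a -> d.+1%:R * a < L ->
  2 / a * L <=
  L + ln d.+1`!%:R - ln 3 - d.+1%:R * ln (2 / a) - d%:R * ln L.
Proof.
move=> d0 a4 La; have a0 : 0 < a by lra.
have D2 : 2 <= d.+1%:R :> R by rewrite ler_nat.
set D : R := d.+1%:R in La D2 *; have D0 : 0 < D by lra.
have L0 : 0 < L by apply: lt_trans La; rewrite mulr_gt0.
have dE : d%:R = D - 1 by rewrite /D -natr1 addrK.
have hf : D * ln D - D <= ln d.+1`!%:R by exact: ln_fact_ge.
pose x := L / D; have x0 : 0 < x by rewrite divr_gt0.
have xa : a < x by rewrite ltr_pdivlMr// mulrC.
have LE : L = D * x by rewrite mulrC divfK// gt_eqF.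
have lL : ln L = ln D + ln x by rewrite LE lnM ?posrE.
have lx0 : 0 <= ln x by rewrite ln_ge0//; lra.
have lx : ln x <= x / a - 1 + ln a.
  have := ln_le_subr1 (divr_gt0 x0 a0); rewrite ln_div//; lra.
have lq : ln (2 / a) = ln 2 - ln a by rewrite ln_div ?posrE.
have l2 : ln 2 <= 1 :> R by have := @ln_le_subr1 R 2; lra.
(* An equality at [D = 2], the smallest value allowed. *)
have l3' : 3 / D - 1 <= D / 4.
  rewrite lerBlDr ler_pdivrMr//; nra.
have l3 : ln 3 - ln D <= D / 4.
  apply: le_trans l3'; rewrite -ln_div ?posrE//; by apply: ln_le_subr1;
    rewrite divr_gt0.
rewrite lq lL dE.
pose y := x / a; have yE : x = y * a by rewrite divfK// gt_eqF.
have y1 : 1 < y by rewrite ltr_pdivlMr// mul1r.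
have -> : 2 / a * L = D * (2 * y) by rewrite LE /y; field; rewrite gt_eqF.
rewrite -/y in lx.
have h1 : (D - 1) * ln x <= D * (y - 1 + ln a).
  apply: (@le_trans _ _ (D * ln x)); first by rewrite ler_wpM2r//; lra.
  by rewrite ler_wpM2l ?(ltW D0).
have h2 : D * ln 2 <= D by rewrite -[leRHS]mulr1 ler_wpM2l// ltW.
(* Here [a >= 17 / 4] and [y > 1] enter. The gain of [5 / 4] per unit of [D] is spent exactly: 1 on
   [ln 2] in [h2] and [1 / 4] on [ln 3 - ln D] in [l3]. *)
have h3 : D * (5 / 4) <= D * (y * a - 3 * y).
  rewrite ler_wpM2l ?(ltW D0)//; nra.
have LE' : L = D * (y * a) by rewrite -yE.
rewrite LE'; move: (ln x) (ln D) (ln a) (ln 2) (ln 3)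
  (ln d.+1`!%:R) hf h1 h2 l3 => lnx lnD lna ln2 ln3 lnf *.
lra.
Qed.

Lemma lower_fill (d n : nat) : (12 * expR 1 ^+ 2) ^+ d.+1 < n%:R :> R ->
  let r : R := n%:R * d.+1`!%:R /
    (3 * (2 / (2 + ln 12)) ^+ d.+1 * ln n%:R ^+ d) in
  exists2 t : seq (d.+1.-tuple int),
    uniq t /\ (forall k, k \in t -> mix_prod k <= r ^+ 2) & (n <= size t)%N.
Proof.
move=> nb r; pose a : R := 2 + ln 12; pose q := 2 / a.
have a4 : 17 / 4 <= a by rewrite /a; have := @ln12_ge R; lra.
have a0 : 0 < a by lra.
have q0 : 0 < q by rewrite divr_gt0.
have e0 : 0 < 12 * expR 1 ^+ 2 :> R by rewrite mulr_gt0// exprn_gt0// expR_gt0.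
have n0 : 0 < n%:R :> R by apply: lt_trans nb; rewrite exprn_gt0.
set L := ln n%:R in r *.
have La : d.+1%:R * a < L.
  have : ln ((12 * expR 1 ^+ 2) ^+ d.+1) < L by rewrite ltr_ln ?posrE//
    exprn_gt0.
  rewrite lnXn// lnM ?posrE ?exprn_gt0 ?expR_gt0// lnXn ?expR_gt0// expRK.
  by rewrite -[(ln 12 + 2) *+ _]mulr_natl /a (addrC 2).
have L0 : 0 < L by apply: lt_trans La; rewrite mulr_gt0.
have f0 : 0 < d.+1`!%:R :> R by rewrite ltr0n fact_gt0.
have D0 : 0 < 3 * q ^+ d.+1 * L ^+ d by rewrite !mulr_gt0 ?exprn_gt0.
have r0 : 0 < r by rewrite divr_gt0// mulr_gt0.
(* In dimension one [2 r - 3 = n a / 3 - 3], which is at least [n] because [a >= 17 / 4] and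
   [n >= 12]. *)
case: d => [|d] in nb r La f0 D0 r0 *.
  have n12 : 12 <= n%:R :> R.
    apply: le_trans (ltW nb); rewrite expr1 ler_peMr// exprn_ege1//.
    by rewrite -[leLHS]expR0 ler_expR.
  have rE : r = n%:R * a / 6.
    rewrite /r (_ : 1`!%:R = 1)// mulr1 expr0 mulr1 expr1 -/a; field.
    by rewrite gt_eqF.
  have [|t ht ts] := @interval_fill r.
    by rewrite rE; move: (n%:R : R) n12 => N *; nra.
  exists t => //; rewrite -(ler_nat R); apply: le_trans ts.
  by rewrite rE; move: (n%:R : R) n12 => N *; nra.
have lr : q * L <= ln r.
  have q1 : 0 < q ^+ d.+2 by exact: exprn_gt0.
  have L1 : 0 < L ^+ d.+1 by exact: exprn_gt0.
  have nf : 0 < n%:R * d.+2`!%:R :> R by exact: mulr_gt0.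
  have -> : ln r = L + ln d.+2`!%:R - (ln 3 + d.+2%:R * ln q + d.+1%:R * ln L).
    rewrite /r -/q (ln_div (x := n%:R * _)) ?posrE//; congr (_ - _).
      by rewrite lnM ?posrE.
    have q3 : 0 < 3 * q ^+ d.+2 by exact: mulr_gt0.
    have -> : ln (3 * q ^+ d.+2 * L ^+ d.+1) =
      ln (3 * q ^+ d.+2) + ln (L ^+ d.+1).
      by rewrite lnM ?posrE.
    have -> : ln (3 * q ^+ d.+2) = ln 3 + ln (q ^+ d.+2) by rewrite lnM ?posrE.
    by rewrite !lnXn// -[ln q *+ _]mulr_natl -[ln L *+ _]mulr_natl.
  apply: le_trans (@ln_radius_ge a L d.+1 isT a4 La) _.
  by rewrite -/q; lra.
have r1 : 1 <= r.
  by rewrite -[r](lnK (x := r))// -[leLHS]expR0 ler_expR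
    (le_trans _ lr)// mulr_ge0 ?ltW.
have [t ht ts] := hyperbolic_fill d.+1 r1; exists t => //.
rewrite -(ler_nat R); apply: le_trans ts.
have hq : (q * L) ^+ d.+1 <= ln r ^+ d.+1.
  by rewrite lerXn2r// nnegrE ?(le_trans _ lr)// mulr_ge0 ?ltW.
apply: (@le_trans _ _ (r * (q * L) ^+ d.+1 / d.+1`!%:R / Num.sqrt 2));
  last first.
  rewrite /fill_bound !ler_wpM2r ?invr_ge0 ?sqrtr_ge0// ler_wpM2l// ltW//.
have s2 : 0 < Num.sqrt 2 :> R by rewrite sqrtr_gt0.
(* The powers of [q] and [L] in [r] cancel up to one [q]. What remains is at least [n], since
   [q <= 8 / 17] gives [3 q sqrt 2 <= 2] and the dimension is at least 2. *)
have -> : r * (q * L) ^+ d.+1 / d.+1`!%:R / Num.sqrt 2 =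
    n%:R * (d.+2%:R / (3 * q * Num.sqrt 2)).
  rewrite /r -/q (factS d.+1) natrM (exprS q d.+1).
  have -> : (q * L) ^+ d.+1 = q ^+ d.+1 * L ^+ d.+1 by rewrite exprMn.
  have : d.+1`!%:R != 0 :> R by rewrite gt_eqF// ltr0n fact_gt0.
  have : q ^+ d.+1 != 0 by rewrite gt_eqF// exprn_gt0.
  have : L ^+ d.+1 != 0 by rewrite gt_eqF// exprn_gt0.
  move: (gt_eqF q0) (gt_eqF s2) => /negbT qn /negbT sn.
  move: (d.+1`!%:R : R) (d.+2%:R : R) (q ^+ d.+1) (L ^+ d.+1) => f D p l *.
  by field; apply/and5P; split.
have qs : 0 < 3 * q * Num.sqrt 2 by rewrite (mulr_gt0 _ s2)// (mulr_gt0 _ q0).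
rewrite ler_peMr ?(ltW n0)// (ler_pdivlMr _ _ qs) mul1r.
apply: (@le_trans _ _ 2); last by rewrite ler_nat.
have q817 : q <= 8 / 17 by rewrite ler_pdivrMr//; lra.
move: q q0 q817 {D0 lr hq r r0 r1 t ht qs} => p p0 p817.
apply: ler_sqr_pos => //; have -> : (3 * p * Num.sqrt 2) ^+ 2 =
  (3 * p) ^+ 2 * 2.
  by rewrite exprMn sqr_sqrtr.
nra.
Qed.

Lemma approximation_lower (s : R) (d n : nat) : 0 < s ->
  (12 * expR 1 ^+ 2) ^+ d.+1 < n%:R :> R ->
  ((((3 / d.+1`!%:R * (2 / (2 + ln 12)) ^+ d.+1) * ln n%:R ^+ d / n%:R) `^
    s)%:E <=
   approximation_number (@Hmix_norm R d.+1 s) (@L2norm R d.+1) n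
    (@Hmix_embedding R d.+1 s))%E.
Proof.
move=> s0 nb; have [t [ut tV] nt] := lower_fill nb.
have n0 : 0 < n%:R :> R.
  by apply: lt_trans nb; rewrite exprn_gt0// mulr_gt0// exprn_gt0// expR_gt0.
have n1 : 1 < n%:R :> R.
  apply: le_lt_trans nb; rewrite exprn_ege1//.
  have : 1 <= expR 1 :> R by rewrite -[leLHS]expR0 ler_expR.
  by move: (expR 1) => e; nra.
have q0 : 0 < 2 / (2 + ln 12) :> R.
  by rewrite divr_gt0//; have := @ln12_ge R; lra.
set Q := _ / n%:R.
have Q0 : 0 < Q.
  by rewrite /Q divr_gt0// !mulr_gt0 ?exprn_gt0 ?ln_gt0 ?invr_gt0 ?ltr0n
    ?fact_gt0.
apply: (@approximation_number_ge R d.+1 s (ltW s0) n t) => //;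
  first exact: powR_ge0.
move=> k /tV Vr; have V1 := @mix_prod_ge1 R _ k.
rewrite mix_weightE sqr_powRM ?(ltW Q0)//; last exact: le_trans V1.
have e1 : 1 `^ s = 1 :> R by rewrite powR1.
rewrite -[leRHS]e1; apply: ge0_ler_powR; rewrite ?nnegrE ?(ltW s0)//.
  by rewrite mulr_ge0 ?sqr_ge0// (le_trans _ V1).
apply: le_trans (ler_wpM2l (sqr_ge0 Q) Vr) _.
(* The radius of [lower_fill] is exactly the inverse of [Q]. *)
rewrite -exprMn (_ : Q * _ = 1) ?expr1n// /Q; field.
by apply/and4P; split; rewrite gt_eqF// ?exprn_gt0 ?ln_gt0 ?ltr0n ?fact_gt0.
Qed.
End MainBounds.

Theorem theorem4p15 (R : realType) (s : R) (d n : nat)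
    (s_gt0 : 0 < s) (d_gt0 : (0 < d)%N) (n_gt0 : (0 < n)%N) :
  let a_n : \bar R :=
    approximation_number (@Hmix_norm R d s) (@L2norm R d) n
      (@Hmix_embedding R d s) in
  ((27 ^ d <= n)%N ->
     (a_n <= (((3 * Num.sqrt 2) ^+ d / (d.-1)`!%:R) `^ s *
              ln n%:R `^ (d.-1%:R * s) / n%:R `^ s)%:E)%E) /\
  ((12 * expR 1 ^+ 2) ^+ d < n%:R :> R ->
     ((((3 / d`!%:R * (2 / (2 + ln 12)) ^+ d) `^ s *
              ln n%:R `^ (d.-1%:R * s) / n%:R `^ s)%:E <= a_n)%E)).
Proof.
case: d d_gt0 => // d _ /=.
have n0 : 0 < n%:R :> R by rewrite ltr0n.
have L0 : 0 <= ln n%:R :> R by rewrite ln_ge0// ler1n.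
have q0 : 0 <= 2 / (2 + ln 12) :> R.
  by rewrite divr_ge0//; have := @ln12_ge R; lra.
split=> hn; rewrite powR_merge//.
- exact: approximation_upper.
- exact: approximation_lower.
- by rewrite mulr_ge0// ?divr_ge0// exprn_ge0.
Qed.
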